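(* Let $p$ be a prime, $n\ge1$, and let $\mathcal{A}\in\mathcal{E}(\mathbb{Q}_p^n\setminus\{0\})$ be the symbol of a homogeneous pseudo-differential operator $A$ of degree $\pi_{\beta}$, where $\pi_\beta$ is a multiplicative character of $\mathbb{Q}_p$. Let $f,g\in\Phi'(\mathbb{Q}_p^n)$ and let $\rho$ be an automodel function on $\mathbb{Q}_p^*$. Then $$f(x)\stackrel{\Phi'}{\sim}g(x),\quad|x|_p\to\infty\quad\big(\rho(t)\big)$$ if and only if $$(Af)(x)\stackrel{\Phi'}{\sim}(Ag)(x),\quad|x|_p\to\infty\quad\big(\pi_{\beta}^{-1}(t)\rho(t)\big).$$
   Context: $\mathbb{Q}_p$ has norm $|p|_p=p^{-1}$; $\mathbb{Q}_p^*=\mathbb{Q}_p\setminus\{0\}$. $\mathcal{D}(\mathbb{Q}_p^n)$ is the space of locally constant compactly supported functions $\mathbb{Q}_p^n\to\mathbb{C}$; $\mathcal{E}(\mathbb{Q}_p^n\setminus\{0\})$ is the space of locally constant functions $\mathbb{Q}_p^n\setminus\{0\}\to\mathbb{C}$. Fourier transform: $F[\varphi](\xi)=\int_{\mathbb{Q}_p^n}\chi_p(\xi\cdot x)\varphi(x)\,d^nx$, with $\chi_p(\xi\cdot x)=e^{2\pi i\sum_j\{\xi_jx_j\}_p}$, $\{\cdot\}_p$ the $p$-adic fractional part, $d^nx$ normalized Haar measure. $\Psi(\mathbb{Q}_p^n)=\{\psi\in\mathcal{D}(\mathbb{Q}_p^n):\psi(0)=0\}$; $\Phi(\mathbb{Q}_p^n)=\{F[\psi]:\psi\in\Psi(\mathbb{Q}_p^n)\}$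 (Lizorkin test functions of the second kind); $\Phi'(\mathbb{Q}_p^n)$ is its topological dual (Lizorkin distributions of the second kind), with weak convergence. The pseudo-differential operator $A$ with symbol $\mathcal{A}\in\mathcal{E}(\mathbb{Q}_p^n\setminus\{0\})$ acts on $\phi\in\Phi$ by $A\phi=F^{-1}[\mathcal{A}\,F[\phi]]\in\Phi$ and on $f\in\Phi'$ by $\langle Af,\phi\rangle=\langle f,A^T\phi\rangle$, $\phi\in\Phi$, where $(A^T\phi)(x)=F^{-1}[\mathcal{A}(-\xi)F[\phi](\xi)](x)$ (elements of $\Psi$ vanish near $0$, so the products are well defined elements of $\Psi$). Multiplicative characters of $\mathbb{Q}_p$ are the functions $\pi_\alpha(z)=|z|_p^{\alpha-1}\pi_1(z)$ on $\mathbb{Q}_p^*$, $\alpha\in\mathbb{C}$, with $\pi_1$ a (continuous) character satisfying $|\pi_1|=1$, $\pi_1(p)=1$. $A$ is homogeneous of degree $\pi_\beta$ if $\mathcal{A}(t\xi)=\pi_\beta(t)\mathcal{A}(\xi)$ for all $t\in\mathbb{Q}_p^*$, $\xi\in\mathbb{Q}_p^n\setminus\{0\}$. An automodel function is a continuous $\rho:\mathbb{Q}_p^*\to\mathbb{C}$ such that for every $z\in\mathbb{Q}_p^*$ the limit $\lim_{|t|_p\to\infty}\rho(tz)/\rho(t)=C(z)$ exists; $C$ is then a multiplicative character. For $t\in\mathbb{Q}_p^*$ and $f\in\Phi'$, $f(tx)$ is defined by $\langle f(tx),\phi(x)\rangle=|t|_p^{-n}\langle f(x),\phi(x/t)\rangle$.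 The notation $f(x)\stackrel{\Phi'}{\sim}g(x)$, $|x|_p\to\infty$ $(\rho(t))$ means: $\frac{f(tx)}{\rho(t)}\to g(x)\not\equiv0$ in $\Phi'(\mathbb{Q}_p^n)$ as $|t|_p\to\infty$, i.e. $\langle f(tx),\phi\rangle/\rho(t)\to\langle g,\phi\rangle$ for all $\phi\in\Phi(\mathbb{Q}_p^n)$.
   Formalization: The symbol is additionally assumed to have no zeros on Q_p^n\{0}; without this the claim fails (for the zero symbol, f ~ g can hold while Ag ≡ 0), and any zero off the origin gives a counterexample. *)

(* Defs.v *)
From HB Require Import structures.
From mathcomp Require Import all_boot all_order all_algebra generic_quotient ring_quotient.
From mathcomp Require Import complex.
From mathcomp Require Import all_classical all_reals all_analysis.
From mathcomp Require Import zify ring lra.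

Set Implicit Arguments.
Unset Strict Implicit.
Unset Printing Implicit Defensive.

Import Order.TTheory GRing.Theory Num.Theory.
Import numFieldNormedType.Exports.

Local Open Scope classical_set_scope.
Local Open Scope ring_scope.
Local Open Scope complex_scope.

Section RatPadicNorm.
Variables (p : nat) (p_pr : prime p).

Definition rat_padic_norm (q : rat) : rat :=
  if q == 0 then 0
  else p%:R ^ ((logn p `|denq q|)%:Z - (logn p `|numq q|)%:Z).

Local Notation N := rat_padic_norm.

Let p_gt0 : 0 < p%:R :> rat. Proof. by rewrite ltr0n prime_gt0. Qed.
Let p_neq0 : p%:R != 0 :> rat. Proof. exact: lt0r_neq0. Qed.
Let p_ge1 : 1 <= p%:R :> rat. Proof. by rewrite ler1n prime_gt0. Qed.

Lemma rat_padic_normE (a b : int) : a != 0 -> b != 0 ->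
  N (a%:~R / b%:~R) = p%:R ^ ((logn p `|b|)%:Z - (logn p `|a|)%:Z).
Proof.
move=> a0 b0; rewrite /N.
have ab0 : a%:~R / b%:~R != 0 :> rat by rewrite mulf_neq0 ?invr_eq0 ?intr_eq0.
rewrite (negPf ab0); set q := _ / _.
have d0 : denq q != 0 by apply: denq_neq0.
have n0 : numq q != 0 by rewrite numq_eq0.
have E : numq q * b = a * denq q.
  apply/eqP; rewrite -(eqr_int rat) !rmorphM /=.
  have -> : (numq q)%:~R = q * (denq q)%:~R by rewrite numqE.
  by rewrite /q mulrAC divfK // intr_eq0.
have : logn p `|numq q * b| = logn p `|a * denq q| by rewrite E.
rewrite !abszM !lognM ?absz_gt0 // => L.
have {}L : (logn p `|numq q|)%:Z + (logn p `|b|)%:Z =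
  (logn p `|a|)%:Z + (logn p `|denq q|)%:Z by rewrite -!PoszD L.
congr (_ ^ _); move: L; lia.
Qed.

Lemma rat_padic_norm0 : N 0 = 0. Proof. by rewrite /N eqxx. Qed.

Lemma rat_padic_norm_gt0 q : q != 0 -> 0 < N q.
Proof. by move=> q0; rewrite /N (negPf q0) exprz_gt0. Qed.

Lemma rat_padic_norm_ge0 q : 0 <= N q.
Proof.
by have [->|/rat_padic_norm_gt0/ltW//] := eqVneq q 0; rewrite rat_padic_norm0.
Qed.

Lemma rat_padic_norm_eq0 q : (N q == 0) = (q == 0).
Proof.
have [->|q0] := eqVneq q 0; first by rewrite rat_padic_norm0 eqxx.
by rewrite gt_eqF // rat_padic_norm_gt0.
Qed.

Lemma rat_padic_norm1 : N 1 = 1.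
Proof. by rewrite /N -[1]/(1%:~R) intr_eq0 numq_int denq_int logn1. Qed.

Lemma rat_padic_normM x y : N (x * y) = N x * N y.
Proof.
have [->|x0] := eqVneq x 0; first by rewrite mul0r rat_padic_norm0 mul0r.
have [->|y0] := eqVneq y 0; first by rewrite mulr0 rat_padic_norm0 mulr0.
have E : x * y = (numq x * numq y)%:~R / (denq x * denq y)%:~R.
  by rewrite !rmorphM /= invfM mulrACA !divq_num_den.
have nz : forall q, q != 0 -> (0 < `|numq q|)%N.
  by move=> q q0; rewrite absz_gt0 numq_eq0.
have dz : forall q, (0 < `|denq q|)%N by move=> q; rewrite absz_gt0 denq_neq0.
rewrite E rat_padic_normE ?mulf_neq0 ?numq_eq0 ?denq_neq0 //.
rewrite /N (negPf x0) (negPf y0) -expfzDr //; congr (_ ^ _).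
by rewrite !abszM !lognM ?nz //; lia.
Qed.

Lemma rat_padic_normN x : N (- x) = N x.
Proof. by rewrite /N oppr_eq0 numqN denqN abszN. Qed.

Lemma rat_padic_normD x y : N (x + y) <= Num.max (N x) (N y).
Proof.
have [->|x0] := eqVneq x 0; first by rewrite add0r le_max lexx orbT.
have [->|y0] := eqVneq y 0; first by rewrite addr0 le_max lexx.
have [->|xy0] := eqVneq (x + y) 0.
  by rewrite rat_padic_norm0 le_max !rat_padic_norm_ge0.
have nz : forall q, q != 0 -> (0 < `|numq q|)%N.
  by move=> q q0; rewrite absz_gt0 numq_eq0.
have dz : forall q, (0 < `|denq q|)%N by move=> q; rewrite absz_gt0 denq_neq0.
pose a : int := numq x * denq y; pose b : int := numq y * denq x.
have La : logn p `|a| = (logn p `|numq x| + logn p `|denq y|)%N.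
  by rewrite abszM lognM ?nz ?dz.
have Lb : logn p `|b| = (logn p `|numq y| + logn p `|denq x|)%N.
  by rewrite abszM lognM ?nz ?dz.
have a_gt0 : (0 < `|a|)%N by rewrite abszM muln_gt0 nz ?dz.
have b_gt0 : (0 < `|b|)%N by rewrite abszM muln_gt0 nz ?dz.
have E : x + y = (a + b)%:~R / (denq x * denq y)%:~R.
  by rewrite -{1}(divq_num_den x) -{1}(divq_num_den y)
             addf_div ?intr_eq0 ?denq_neq0 // !(rmorphD, rmorphM).
have ab0 : a + b != 0.
  by apply: contraNneq xy0 => ab0; rewrite E ab0 mul0r.
have minab k : (k <= logn p `|a|)%N -> (k <= logn p `|b|)%N ->
    (k <= logn p (absz (a + b)%R))%N.
  rewrite -!pfactor_dvdn //; last by rewrite absz_gt0.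
  move=> ha hb.
  have : ((p ^ k)%N%:Z %| a + b)%Z by rewrite rpredD // dvdzE.
  by rewrite dvdzE.
rewrite E rat_padic_normE ?mulf_neq0 ?denq_neq0 // /N (negPf x0) (negPf y0).
rewrite le_max abszM lognM ?dz //.
case: (leqP (logn p `|a|) (logn p `|b|)) => h.
  have := minab _ (leqnn _) h; rewrite La => h1.
  by apply/orP; left; apply: ler_weXz2l => //; lia.
have := minab _ (ltnW h) (leqnn _); rewrite Lb => h1.
by apply/orP; right; apply: ler_weXz2l => //; lia.
Qed.

End RatPadicNorm.

Section PadicCauchy.
Variables (p : nat) (p_pr : prime p).
Local Notation N := (rat_padic_norm p).

Definition padic_cauchy (u : nat -> rat) : Prop :=
  forall e : rat, 0 < e ->
    exists K, forall i j, (K <= i)%N -> (K <= j)%N -> N (u i - u j) < e.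

Definition padic_null (u : nat -> rat) : Prop :=
  forall e : rat, 0 < e -> exists K, forall i, (K <= i)%N -> N (u i) < e.

Let N0 := rat_padic_norm0 p.
Let N1 := rat_padic_norm1 p.
Let NM := rat_padic_normM p_pr.
Let NN := rat_padic_normN p.
Let ND := rat_padic_normD p_pr.
Let Nge0 := rat_padic_norm_ge0 p_pr.
Let Neq0 := rat_padic_norm_eq0 p_pr.

Let NB x y : N (x - y) <= Num.max (N x) (N y).
Proof. by rewrite -(NN y) ND. Qed.

Let NBC x y : N (x - y) = N (y - x).
Proof. by rewrite -(NN (y - x)) opprB. Qed.

Lemma rat_padic_norm_dominant x y : N (x - y) < N y -> N x = N y.
Proof.
move=> h; apply/le_anti/andP; split.
  by have := ND (x - y) y; rewrite subrK le_max leNgt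
     => /orP[/negP hh|//]; rewrite leNgt; apply/negP => /(lt_trans h).
have := NB x (x - y); rewrite opprB addrC subrK le_max => /orP[//|].
by rewrite leNgt h.
Qed.

Lemma padic_cauchy_bounded u : padic_cauchy u ->
  exists2 B : rat, 0 < B & exists K, forall i, (K <= i)%N -> N (u i) <= B.
Proof.
move=> /(_ 1 ltr01)[K hK]; exists (Num.max 1 (N (u K))).
  by rewrite lt_max ltr01.
exists K => i Ki; have := ND (u i - u K) (u K); rewrite subrK.
move=> /le_trans; apply; rewrite ge_max !le_max lexx orbT andbT.
by rewrite ltW // hK.
Qed.

Lemma padic_cauchy_cst q : padic_cauchy (cst q).
Proof. by move=> e e0; exists 0%N => i j _ _; rewrite /= subrr N0. Qed.

Lemma padic_cauchyB u v :
  padic_cauchy u -> padic_cauchy v -> padic_cauchy (u - v).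
Proof.
move=> hu hv e e0; have [K1 h1] := hu e e0; have [K2 h2] := hv e e0.
exists (maxn K1 K2) => i j; rewrite !geq_max => /andP[i1 i2] /andP[j1 j2].
have -> : (u - v) i - (u - v) j = (u i - u j) - (v i - v j).
  by rewrite !fctE; ring.
by apply: le_lt_trans (NB _ _) _; rewrite gt_max h1 ?h2.
Qed.

Lemma padic_cauchyM u v :
  padic_cauchy u -> padic_cauchy v -> padic_cauchy (u * v).
Proof.
move=> hu hv e e0.
have [Bu Bu0 [Ku bu]] := padic_cauchy_bounded hu.
have [Bv Bv0 [Kv bv]] := padic_cauchy_bounded hv.
have [K1 h1] := hu (e / Bv) (divr_gt0 e0 Bv0).
have [K2 h2] := hv (e / Bu) (divr_gt0 e0 Bu0).
exists (maxn (maxn Ku Kv) (maxn K1 K2)) => i j.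
rewrite !geq_max => /andP[/andP[iu iv] /andP[i1 i2]].
move=> /andP[/andP[ju jv] /andP[j1 j2]].
have -> : (u * v) i - (u * v) j = u i * (v i - v j) + (u i - u j) * v j.
  by rewrite !fctE; ring.
apply: le_lt_trans (ND _ _) _; rewrite gt_max !NM; apply/andP; split.
  apply: le_lt_trans (_ : Bu * N (v i - v j) < _).
    by rewrite ler_wpM2r ?bu.
  by rewrite mulrC -ltr_pdivlMr ?h2.
apply: le_lt_trans (_ : N (u i - u j) * Bv < _).
  by rewrite ler_wpM2l ?bv.
by rewrite -ltr_pdivlMr ?h1.
Qed.

Lemma padic_cauchy_norm u : padic_cauchy u -> ~ padic_null u ->
  exists2 r : rat, 0 < r & exists K, forall i, (K <= i)%N -> N (u i) = r.
Proof.
move=> hu /existsNP[e /not_implyP[e0 /forallNP nn]].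
have [K hK] := hu e e0.
have /existsNP[i /not_implyP[Ki /negP]] := nn K.
rewrite -leNgt => ei; exists (N (u i)); first exact: lt_le_trans ei.
exists K => j Kj; apply: rat_padic_norm_dominant; apply: lt_le_trans ei; exact: hK.
Qed.

End PadicCauchy.
Section PadicField.
Variables (p : nat) (p_pr : prime p).
Local Notation N := (rat_padic_norm p).

Definition padic_cauchy_pred of prime p : pred (nat -> rat) :=
  fun u => `[< padic_cauchy p u >].
Local Notation cauchyP := (padic_cauchy_pred p_pr).

Lemma padic_cauchy_subring : subring_closed cauchyP.
Proof.
split=> [|u v /asboolP hu /asboolP hv|u v /asboolP hu /asboolP hv]; apply/asboolP.
- exact: padic_cauchy_cst.
- exact: padic_cauchyB.
- exact: padic_cauchyM.
Qed.
HB.instance Definition _ :=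
  GRing.isSubringClosed.Build (nat -> rat) cauchyP padic_cauchy_subring.

Record padic_seq := PadicSeq { padic_seq_val : nat -> rat ;
  padic_seqP : cauchyP padic_seq_val }.
HB.instance Definition _ := [isSub for padic_seq_val].
HB.instance Definition _ := [Choice of padic_seq by <:].
HB.instance Definition _ := [SubChoice_isSubComNzRing of padic_seq by <:].

Definition padic_null_ideal : pred padic_seq :=
  fun u => `[< padic_null p (val u) >].

Lemma padic_null_idealr : idealr_closed padic_null_ideal.
Proof.
split=> [||a u v /asboolP hu /asboolP hv].
- apply/asboolP => e e0; exists 0%N => i _.
  by rewrite rmorph0 /= rat_padic_norm0.
- apply/asboolP => /(_ 1 ltr01)[K /(_ K (leqnn _))].
  by rewrite rmorph1 /= rat_padic_norm1 ltxx.
- apply/asboolP => e e0.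
  have [B B0 [K1 h1]] := padic_cauchy_bounded p_pr (asboolW (padic_seqP a)).
  have [K2 h2] := hu (e / B) (divr_gt0 e0 B0); have [K3 h3] := hv e e0.
  exists (maxn K1 (maxn K2 K3)) => i; rewrite !geq_max => /and3P[i1 i2 i3].
  rewrite rmorphD rmorphM /=.
  apply: le_lt_trans (rat_padic_normD p_pr _ _) _.
  rewrite gt_max h3 // andbT rat_padic_normM //.
  apply: le_lt_trans (_ : B * N (val u i) < _).
    by rewrite ler_wpM2r ?h1 ?rat_padic_norm_ge0.
  by rewrite mulrC -ltr_pdivlMr ?h2.
Qed.
HB.instance Definition _ :=
  isIdealr.Build padic_seq padic_null_ideal padic_null_idealr.

(* Q_p, as the completion of the rationals: Cauchy sequences for the p-adic
   norm modulo null sequences. *)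
Definition padic : Type := {ideal_quot (padic_null_ideal : idealr padic_seq)}.
HB.instance Definition _ := GRing.ComNzRing.on padic.

Definition padic_of_seq (u : padic_seq) : padic :=
  \pi_({ideal_quot (padic_null_ideal : idealr padic_seq)})%qT u.

Lemma padic_of_seqK (x : padic) : padic_of_seq (repr x) = x.
Proof. exact: reprK. Qed.

Lemma padic_of_seqB u v : padic_of_seq (u - v) = padic_of_seq u - padic_of_seq v.
Proof. by rewrite /padic_of_seq !piE. Qed.

Lemma padic_of_seqD u v : padic_of_seq (u + v) = padic_of_seq u + padic_of_seq v.
Proof. by rewrite /padic_of_seq !piE. Qed.

Lemma padic_of_seqM u v : padic_of_seq (u * v) = padic_of_seq u * padic_of_seq v.
Proof. by rewrite /padic_of_seq !piE. Qed.

Lemma padic_of_seq1 : padic_of_seq 1 = 1.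
Proof. by rewrite /padic_of_seq !piE. Qed.

Lemma padic_of_seq0 : padic_of_seq 0 = 0.
Proof. by rewrite /padic_of_seq !piE. Qed.

Lemma padic_of_seq_eq0 u : padic_of_seq u = 0 <-> padic_null p (val u).
Proof.
rewrite -padic_of_seq0 /padic_of_seq; split=> [/eqP|h].
  by rewrite -Quotient.idealrBE subr0 => /asboolP.
by apply/eqP; rewrite -Quotient.idealrBE subr0; apply/asboolP.
Qed.

Lemma padic_inv_ex (x : padic) : x != 0 -> exists y : padic, y * x = 1.
Proof.
rewrite -(padic_of_seqK x); set u := repr x => /eqP u0.
have nu : ~ padic_null p (val u) by move=> /padic_of_seq_eq0.
have [r r0 [K hK]] := padic_cauchy_norm p_pr (asboolW (padic_seqP u)) nu.
have unz i : (K <= i)%N -> val u i != 0.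
  by move=> Ki; rewrite -(rat_padic_norm_eq0 p_pr) hK // gt_eqF.
have cv : padic_cauchy p (fun i => (val u i)^-1).
  move=> e e0; have rr : 0 < r * r by rewrite mulr_gt0.
  have [K' hK'] := asboolW (padic_seqP u) (e * (r * r)) (mulr_gt0 e0 rr).
  exists (maxn K K') => i j; rewrite !geq_max => /andP[i1 i2] /andP[j1 j2].
  have E : val u j - val u i = ((val u i)^-1 - (val u j)^-1) * (val u i * val u j).
    by field; rewrite !unz.
  have := hK' _ _ j2 i2; rewrite -/(val u _) E !rat_padic_normM // !hK //.
  by rewrite ltr_pM2r.
exists (padic_of_seq (PadicSeq (asboolT cv))).
rewrite -padic_of_seqM -padic_of_seq1; apply/eqP.
rewrite -subr_eq0 -padic_of_seqB; apply/eqP/padic_of_seq_eq0 => e e0.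
exists K => i Ki; rewrite rmorphB rmorphM rmorph1 /= !fctE.
by rewrite mulVf ?unz // subrr rat_padic_norm0.
Qed.

Definition padic_inv (x : padic) : padic := xget 0 [set y | y * x = 1].

Lemma padic_mulVx (x : padic) : x != 0 -> padic_inv x * x = 1.
Proof.
by move=> /padic_inv_ex[y yx]; rewrite /padic_inv; case: xgetP => // /(_ y)/(_ yx).
Qed.

Lemma padic_inv0 : padic_inv 0 = 0.
Proof.
rewrite /padic_inv; case: xgetP => // y _ /= /eqP.
by rewrite mulr0 eq_sym oner_eq0.
Qed.

HB.instance Definition _ :=
  GRing.ComNzRing_isField.Build padic padic_mulVx padic_inv0.

(* Along a Cauchy sequence the norm is eventually constant, except for null
   sequences, for which the default value 0 is the intended one. *)
Definition padic_norm (x : padic) : rat :=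
  xget 0 [set r | exists K, forall i, (K <= i)%N -> N (val (repr x) i) = r].

Lemma padic_norm_seq u : ~ padic_null p (val u) ->
  exists K, forall i, (K <= i)%N -> N (val u i) = padic_norm (padic_of_seq u).
Proof.
move=> nu; set v := repr (padic_of_seq u).
have vu0 : padic_null p (val v - val u).
  rewrite -rmorphB; apply/padic_of_seq_eq0.
  by rewrite padic_of_seqB padic_of_seqK subrr.
have [r r0 [K hK]] := padic_cauchy_norm p_pr (asboolW (padic_seqP u)) nu.
have [K' hK'] := vu0 r r0.
have hv i : (maxn K K' <= i)%N -> N (val v i) = r.
  rewrite geq_max => /andP[i1 i2]; rewrite -(hK i i1).
  apply: (rat_padic_norm_dominant p_pr); rewrite hK //; exact: hK'.
rewrite /padic_norm -/v; case: xgetP => [s _ [L hL]|/(_ r)h]; last first.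
  by exfalso; apply: h; exists (maxn K K').
have <- : r = s.
  pose M := maxn L (maxn K K').
  by rewrite -(hL M) ?leq_maxl // hv // leq_maxr.
by exists K.
Qed.

Lemma padic_norm0 : padic_norm 0 = 0.
Proof.
have hv : padic_null p (val (repr (0 : padic))).
  by apply/padic_of_seq_eq0; rewrite padic_of_seqK.
rewrite /padic_norm; case: xgetP => // r _ [K hK]; apply/eqP.
apply: contraT => r0.
have r_gt0 : 0 < r by rewrite lt_def r0 -(hK K) // rat_padic_norm_ge0.
have [K' hK'] := hv r r_gt0.
by have := hK' _ (leq_maxr K K'); rewrite hK ?leq_maxl // ltxx.
Qed.

Lemma padic_norm_repr (x : padic) : x != 0 ->
  exists K, forall i, (K <= i)%N -> N (val (repr x) i) = padic_norm x.
Proof.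
move=> x0; rewrite -[X in padic_norm X]padic_of_seqK; apply: padic_norm_seq.
by move=> /padic_of_seq_eq0; rewrite padic_of_seqK; exact/eqP.
Qed.

Lemma padic_norm_gt0 (x : padic) : x != 0 -> 0 < padic_norm x.
Proof.
move=> x0; have [K hK] := padic_norm_repr x0.
have nu : ~ padic_null p (val (repr x)).
  by move=> /padic_of_seq_eq0; rewrite padic_of_seqK; exact/eqP.
have [r r0 [K' hK']] := padic_cauchy_norm p_pr (asboolW (padic_seqP (repr x))) nu.
by rewrite -(hK _ (leq_maxl K K')) hK' // leq_maxr.
Qed.

Lemma padic_norm_ge0 (x : padic) : 0 <= padic_norm x.
Proof.
by have [->|/padic_norm_gt0/ltW//] := eqVneq x 0; rewrite padic_norm0.
Qed.

Lemma padic_norm_eq0 (x : padic) : (padic_norm x == 0) = (x == 0).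
Proof.
have [->|x0] := eqVneq x 0; first by rewrite padic_norm0 eqxx.
by rewrite gt_eqF // padic_norm_gt0.
Qed.

Lemma padic_norm_le (u : padic_seq) (c : rat) : 0 <= c ->
  (exists K, forall i, (K <= i)%N -> N (val u i) <= c) ->
  padic_norm (padic_of_seq u) <= c.
Proof.
move=> c0 [K hK]; have [nu|nu] := pselect (padic_null p (val u)).
  by rewrite (padic_of_seq_eq0 u).2 // padic_norm0.
have [K' hK'] := padic_norm_seq nu.
by rewrite -(hK' _ (leq_maxr K K')) hK // leq_maxl.
Qed.

Lemma padic_norm_repr_le (x : padic) (c : rat) : 0 < c -> padic_norm x <= c ->
  exists K, forall i, (K <= i)%N -> N (val (repr x) i) <= c.
Proof.
move=> c0; have [->|x0] := eqVneq x 0.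
  have hv : padic_null p (val (repr (0 : padic))).
    by apply/padic_of_seq_eq0; rewrite padic_of_seqK.
  by have [K hK] := hv c c0; exists K => i /hK/ltW.
by have [K hK] := padic_norm_repr x0 => xc; exists K => i /hK ->.
Qed.

Lemma padic_normD (x y : padic) :
  padic_norm (x + y) <= Num.max (padic_norm x) (padic_norm y).
Proof.
have [->|x0] := eqVneq x 0; first by rewrite add0r le_max lexx orbT.
have m0 : 0 < Num.max (padic_norm x) (padic_norm y).
  by rewrite lt_max padic_norm_gt0.
have [K1 h1] : exists K, forall i, (K <= i)%N ->
    N (val (repr x) i) <= Num.max (padic_norm x) (padic_norm y).
  by apply: padic_norm_repr_le => //; rewrite le_max lexx.
have [K2 h2] : exists K, forall i, (K <= i)%N ->
    N (val (repr y) i) <= Num.max (padic_norm x) (padic_norm y).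
  by apply: padic_norm_repr_le => //; rewrite le_max lexx orbT.
rewrite -[X in padic_norm (X + _)]padic_of_seqK.
rewrite -[X in padic_norm (_ + X)]padic_of_seqK -padic_of_seqD.
apply: padic_norm_le (ltW m0) _; exists (maxn K1 K2) => i.
rewrite geq_max => /andP[i1 i2]; rewrite rmorphD /=.
by apply: le_trans (rat_padic_normD p_pr _ _) _; rewrite ge_max h1 ?h2.
Qed.

Lemma padic_normM (x y : padic) :
  padic_norm (x * y) = padic_norm x * padic_norm y.
Proof.
have [->|x0] := eqVneq x 0; first by rewrite mul0r padic_norm0 mul0r.
have [->|y0] := eqVneq y 0; first by rewrite mulr0 padic_norm0 mulr0.
have xy0 : ~ padic_null p (val (repr x * repr y)).
  move=> /padic_of_seq_eq0; rewrite padic_of_seqM !padic_of_seqK.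
  by apply/eqP; rewrite mulf_neq0.
have [K hK] := padic_norm_seq xy0.
have [K1 h1] := padic_norm_repr x0; have [K2 h2] := padic_norm_repr y0.
pose M := maxn K (maxn K1 K2).
have KM : (K <= M)%N by rewrite leq_maxl.
have K1M : (K1 <= M)%N by rewrite (leq_trans (leq_maxl K1 K2)) ?leq_maxr.
have K2M : (K2 <= M)%N by rewrite (leq_trans (leq_maxr K1 K2)) ?leq_maxr.
have := hK M KM; rewrite padic_of_seqM !padic_of_seqK => <-.
by rewrite rmorphM -(h1 M) // -(h2 M) // -rat_padic_normM.
Qed.

Lemma padic_norm1 : padic_norm 1 = 1.
Proof.
apply: (@mulfI _ (padic_norm 1)); first by rewrite padic_norm_eq0 oner_eq0.
by rewrite -padic_normM !mulr1.
Qed.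

Lemma padic_normN (x : padic) : padic_norm (- x) = padic_norm x.
Proof.
have e1 : padic_norm (-1) = 1.
  have h : padic_norm (-1) ^+ 2 == 1.
    by rewrite expr2 -padic_normM mulrNN mulr1 padic_norm1.
  by apply/eqP; rewrite -(@eqrXn2 _ 2) ?expr1n ?padic_norm_ge0 ?ler01.
by rewrite -mulN1r padic_normM e1 mul1r.
Qed.

Lemma padic_of_seq_is_zmod : zmod_morphism padic_of_seq.
Proof. exact: padic_of_seqB. Qed.
HB.instance Definition _ :=
  GRing.isZmodMorphism.Build padic_seq padic padic_of_seq padic_of_seq_is_zmod.
Lemma padic_of_seq_is_monoid : monoid_morphism padic_of_seq.
Proof. by split; [exact: padic_of_seq1 | exact: padic_of_seqM]. Qed.
HB.instance Definition _ :=
  GRing.isMonoidMorphism.Build padic_seq padic padic_of_seq padic_of_seq_is_monoid.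

Lemma padic_seq_int (m : int) i : val (m%:~R : padic_seq) i = m%:~R.
Proof.
have En k : ((k%:R : nat -> rat) i = k%:R).
  by elim: k => // k IH; rewrite !mulrS fctE IH.
rewrite rmorph_int; case: m => k; first by rewrite -!pmulrn En.
by rewrite NegzE !mulrNz -!pmulrn; congr (- _); exact: En.
Qed.

Lemma padic_norm_int (m : int) : padic_norm m%:~R = N m%:~R.
Proof.
have [->|m0] := eqVneq m 0; first by rewrite padic_norm0 rat_padic_norm0.
have nu : ~ padic_null p (val (m%:~R : padic_seq)).
  have m_gt0 : 0 < N m%:~R by rewrite rat_padic_norm_gt0 // intr_eq0.
  by move=> /(_ _ m_gt0)[K /(_ K (leqnn _))]; rewrite padic_seq_int ltxx.
have [K hK] := padic_norm_seq nu.
by rewrite -(rmorph_int padic_of_seq) -(hK K) // padic_seq_int.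
Qed.

Lemma padic_norm_ratr (q : rat) : padic_norm (ratr q) = N q.
Proof.
have nz (m : int) : m != 0 -> (m%:~R : padic) != 0.
  by move=> m0; rewrite -padic_norm_eq0 padic_norm_int rat_padic_norm_eq0 ?intr_eq0.
have d0 := nz _ (denq_neq0 q).
apply: (@mulIf _ (padic_norm (denq q)%:~R)); first by rewrite padic_norm_eq0.
by rewrite -padic_normM /ratr divfK // !padic_norm_int -rat_padic_normM // -numqE.
Qed.

Lemma padic_norm_p : padic_norm p%:R = p%:R^-1.
Proof.
rewrite [p%:R]pmulrn padic_norm_int -[_%:~R]divr1 -[X in _ / X]/(1%:~R).
rewrite rat_padic_normE //; last by rewrite -lt0n prime_gt0.
by rewrite /= logn1 logn_prime // eqxx.
Qed.

Lemma padic_of_seq_cst (q : rat) :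
  padic_of_seq (PadicSeq (asboolT (padic_cauchy_cst p q))) = ratr q.
Proof.
have d0 : ((denq q)%:~R : padic) != 0.
  by rewrite -padic_norm_eq0 padic_norm_int rat_padic_norm_eq0 ?intr_eq0 ?denq_neq0.
apply: (mulIf d0); rewrite /ratr divfK // -!(rmorph_int padic_of_seq) -rmorphM.
congr padic_of_seq; apply: val_inj; apply/funext => i.
by rewrite rmorphM /= fctE !padic_seq_int numqE.
Qed.

Lemma padic_ratrB (q r : rat) : ratr (q - r) = ratr q - ratr r :> padic.
Proof.
rewrite -!padic_of_seq_cst -padic_of_seqB.
by congr padic_of_seq; apply: val_inj.
Qed.

Lemma padic_ratr_dense (x : padic) (e : rat) : 0 < e ->
  exists q : rat, padic_norm (x - ratr q) < e.
Proof.
move=> e0; have e20 : 0 < e / 2 by rewrite divr_gt0.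
set u := repr x; have [K hK] := asboolW (padic_seqP u) _ e20.
exists (val u K); apply: le_lt_trans (_ : e / 2 < e); last by lra.
rewrite -[x in x - _]padic_of_seqK -padic_of_seq_cst -padic_of_seqB.
apply: padic_norm_le (ltW e20) _; exists K => i Ki.
by rewrite rmorphB /= fctE ltW // hK.
Qed.

(* {x}_p is the only element of Z[1/p] in [0, 1[ congruent to x mod Z_p. *)
Definition padic_frac_of (x : padic) : set rat :=
  [set q | [/\ 0 <= q < 1, exists k : nat, q * p%:R ^+ k \is a Num.int
            & padic_norm (x - ratr q) <= 1]].

Definition padic_frac (x : padic) : rat := get (padic_frac_of x).

Let p_gt1 : 1 < p%:R :> rat. Proof. by rewrite ltr1n prime_gt1. Qed.
Let p_neq0 : p%:R != 0 :> rat.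
Proof. by rewrite pnatr_eq0 -lt0n prime_gt0. Qed.

Lemma rat_padic_norm_int (z : int) : z != 0 -> N z%:~R = p%:R ^- logn p `|z|.
Proof.
move=> z0; rewrite -[z%:~R]divr1 -[X in _ / X]/(1%:~R) rat_padic_normE //.
by rewrite /= logn1 sub0r exprnN.
Qed.

Lemma rat_padic_norm_int_le (z : int) (k : nat) :
  (N z%:~R <= p%:R ^- k) = ((p ^ k)%N%:Z %| z)%Z.
Proof.
have [->|z0] := eqVneq z 0.
  by rewrite rat_padic_norm0 dvdz0 invr_ge0 exprn_ge0 ?ler0n.
rewrite rat_padic_norm_int // lef_pV2 ?posrE ?exprn_gt0 ?ltr0n ?prime_gt0 //.
by rewrite ler_eXn2l // dvdzE /= pfactor_dvdn // absz_gt0.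
Qed.

Lemma padic_frac_ex (x : padic) : exists q, padic_frac_of x q.
Proof.
have [q0 hq0] := padic_ratr_dense x ltr01.
have d_gt0 : (0 < `|denq q0|)%N by rewrite absz_gt0 denq_neq0.
have [m cpm] := pfactor_coprime p_pr d_gt0.
set k := logn p _ => dE.
have m_gt0 : (0 < m)%N by move: d_gt0; rewrite dE; case: (m).
have m0 : (m%:R : rat) != 0 by rewrite pnatr_eq0 -lt0n.
have pk0 : (p%:R ^+ k : rat) != 0 by rewrite expf_neq0.
set a := numq q0.
have q0E : q0 = a%:~R / (m%:R * p%:R ^+ k).
  rewrite -[LHS]divq_num_den; congr (_ / _).
  by rewrite -absz_denq dE -pmulrn natrM natrX.
have cop : coprimez m (p ^ k)%N by rewrite coprimezE /= coprimeXr // coprime_sym.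
have [[u v] /= uv] := coprimezP _ _ cop.
pose c := (a * u)%R; pose P : int := (p ^ k)%N.
have P_gt0 : 0 < P by rewrite ltz_nat expn_gt0 prime_gt0.
have PE : P%:~R = p%:R ^+ k :> rat by rewrite -pmulrn natrX.
pose r := (c %% P)%Z; exists (r%:~R / p%:R ^+ k); split.
- rewrite divr_ge0 ?exprn_ge0 ?ler0n ?ler0z ?modz_ge0 ?gt_eqF //=.
  by rewrite ltr_pdivrMr ?exprn_gt0 ?ltr0n ?prime_gt0 // mul1r -PE ltr_int ltz_pmod.
- by exists k; rewrite divfK.
rewrite -(subrKA (ratr q0)); apply: le_trans (padic_normD _ _) _.
rewrite ge_max (ltW hq0) /= -padic_ratrB padic_norm_ratr.
have rE : r = c - (c %/ P)%Z * P by rewrite {1}(divz_eq c P) addrC addKr.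
have uvQ : u%:~R * m%:R + v%:~R * p%:R ^+ k = 1 :> rat.
  by rewrite -PE [m%:R]pmulrn -!rmorphM -rmorphD /= uv.
have -> : q0 - r%:~R / p%:R ^+ k = (a * v + (c %/ P)%Z * m)%:~R / m%:R.
  rewrite rE q0E rmorphB rmorphD !rmorphM /= PE -pmulrn.
  have -> : u%:~R = (1 - v%:~R * p%:R ^+ k) / m%:R :> rat.
    by apply: (mulIf m0); rewrite divfK // -[X in X - _]uvQ addrK.
  by field; rewrite m0 pk0.
rewrite rat_padic_normM //.
have -> : N m%:R^-1 = 1.
  have Nm : N m%:R = 1.
    rewrite [m%:R]pmulrn rat_padic_norm_int ?gt_eqF // /=.
    by rewrite logn_coprime ?expr0 ?invr1.
  apply: (@mulIf _ (N m%:R)); first by rewrite Nm oner_eq0.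
  by rewrite -rat_padic_normM // mulVf // Nm mulr1 rat_padic_norm1.
rewrite mulr1; have := rat_padic_norm_int_le (a * v + (c %/ P)%Z * m) 0.
by rewrite expr0 invr1 expn0 dvd1z => ->.
Qed.

Lemma padic_frac_uniq (x : padic) q r :
  padic_frac_of x q -> padic_frac_of x r -> q = r.
Proof.
move=> [/andP[q0 q1] [k /intrP[a qk]] xq] [/andP[r0 r1] [l /intrP[b rl]] xr].
have pk0 i : (p%:R ^+ i : rat) != 0 by rewrite expf_neq0.
have Nqr : N (q - r) <= 1.
  rewrite -padic_norm_ratr padic_ratrB -(subrKA x); apply: le_trans (padic_normD _ _) _.
  by rewrite ge_max xr andbT -padic_normN opprB.
pose z : int := a * (p ^ l)%N - b * (p ^ k)%N.
have zE : z%:~R = (q - r) * p%:R ^+ (k + l) :> rat.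
  by rewrite rmorphB !rmorphM /= -!pmulrn !natrX -qk -rl exprD; ring.
have : ((p ^ (k + l))%N%:Z %| z)%Z.
  rewrite -rat_padic_norm_int_le zE rat_padic_normM //.
  have -> : N (p%:R ^+ (k + l)) = p%:R ^- (k + l).
    rewrite -natrX [_%:R]pmulrn rat_padic_norm_int /=; last first.
      by rewrite gt_eqF // ltz_nat expn_gt0 prime_gt0.
    by rewrite pfactorK // -pmulrn natrX.
  by rewrite ler_piMl // invr_ge0 exprn_ge0 ?ler0n.
move=> /dvdzP[y zy]; have qry : q - r = y%:~R.
  apply: (mulIf (pk0 (k + l)%N)); rewrite -zE zy rmorphM /= -pmulrn natrX //.
have /andP[y1 y2] : (-1 < y) && (y < 1).
  by rewrite -!(ltr_int rat) -qry; apply/andP; split; lra.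
have y0 : y = 0 by lia.
by apply/eqP; rewrite -subr_eq0 qry y0.
Qed.

Definition padic_dist (x y : padic) : rat := padic_norm (x - y).

Lemma padic_distxx x : padic_dist x x = 0.
Proof. by rewrite /padic_dist subrr padic_norm0. Qed.

Lemma padic_dist_positivity x y : padic_dist x y = 0 -> x = y.
Proof. by move=> /eqP; rewrite padic_norm_eq0 subr_eq0 => /eqP. Qed.

Lemma padic_dist_sym x y : padic_dist x y = padic_dist y x.
Proof. by rewrite /padic_dist -opprB padic_normN. Qed.

Lemma padic_dist_triangle y x z :
  padic_dist x z <= padic_dist x y + padic_dist y z.
Proof.
rewrite /padic_dist -(subrKA y); apply: le_trans (padic_normD _ _) _.
by rewrite ge_max lerDl lerDr !padic_norm_ge0.
Qed.

HB.instance Definition _ := isPointed.Build padic 0.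
HB.instance Definition _ := @isMetric.Build rat padic padic_dist padic_distxx
  padic_dist_positivity padic_dist_sym padic_dist_triangle.

End PadicField.
HB.instance Definition _ (R : realType) := PseudoPointedMetric.copy R[i] R[i]^o.

Section ComplexFunctions.
Variable R : realType.
Local Notation C := R[i].

Definition cexp (z : C) : C :=
  (expR (complex.Re z) * cos (complex.Im z)) +i*
  (expR (complex.Re z) * sin (complex.Im z)).

Definition cintegral d (T : measurableType d) (mu : {measure set T -> \bar R})
    (f : T -> C) : C :=
  (\int[mu]_x complex.Re (f x)) +i* (\int[mu]_x complex.Im (f x)).

End ComplexFunctions.

Section PadicAnalysis.
Variables (R : realType) (p : nat) (p_pr : prime p).
Local Notation C := R[i].
Local Notation Qp := (padic p_pr).

Definition padic_char (x : Qp) : C :=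
  cexp (0 +i* (2 * pi * ratr (padic_frac x))).

(* The filter of the neighbourhoods of infinity, i.e. |t|_p -> oo. *)
Definition padic_infty : set_system Qp :=
  [set P | exists M : rat, forall t, M < padic_norm t -> P t].

#[global] Instance padic_infty_filter : ProperFilter padic_infty.
Proof.
split=> [[M hM]|]; last first.
  split=> [|P Q [M hM] [M' hM']|P Q PQ [M hM]]; first by exists 0.
    exists (Num.max M M') => t; rewrite gt_max => /andP[h h'].
    by split; [exact: hM | exact: hM'].
  by exists M => t /hM; exact: PQ.
pose k := Num.bound `|M|; apply: (hM (p%:R ^- k)).
have normX (x : Qp) i : padic_norm (x ^+ i) = padic_norm x ^+ i.
  by elim: i => [|i IH]; rewrite ?padic_norm1 // !exprS padic_normM IH.
have normV (x : Qp) : x != 0 -> padic_norm x^-1 = (padic_norm x)^-1.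
  move=> x0; have nx0 : padic_norm x != 0 by rewrite padic_norm_eq0.
  by apply: (mulIf nx0); rewrite -padic_normM !mulVf // padic_norm1.
have p0 : (p%:R : Qp) != 0.
  by rewrite -padic_norm_eq0 padic_norm_p invr_eq0 pnatr_eq0 -lt0n prime_gt0.
rewrite normV ?expf_neq0 // normX padic_norm_p exprVn invrK.
apply: le_lt_trans (ler_norm M) _; apply: lt_trans (archi_boundP (normr_ge0 M)) _.
by rewrite -natrX ltr_nat ltn_expl ?prime_gt1.
Qed.

(* Functions on Q_p^* (resp. on Q_p^n minus the origin) are represented by total
   functions whose value at 0 is irrelevant. *)
Definition is_unitary_char (pi1 : Qp -> C) : Prop :=
  [/\ forall z, z != 0 -> {for z, continuous pi1},
      forall x y, x != 0 -> y != 0 -> pi1 (x * y) = pi1 x * pi1 y,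
      forall z, z != 0 -> `|pi1 z| = 1 &
      pi1 p%:R = 1].

Definition mult_char (alpha : C) (pi1 : Qp -> C) (z : Qp) : C :=
  cexp ((alpha - 1) * (ln (ratr (padic_norm z)))%:C) * pi1 z.

(* The quotients below are to make sense for all large |t|_p, which total
   division does not express by itself: hence the second clause. The limit is
   then automatically multiplicative in z. *)
Definition automodel (rho : Qp -> C) : Prop :=
  [/\ forall t, t != 0 -> {for t, continuous rho},
      (\forall t \near padic_infty, rho t != 0) &
      forall z, z != 0 ->
        exists c : C, (fun t => rho (t * z) / rho t) @ padic_infty --> c].

Variable n : nat.
Local Notation V := 'rV[Qp]_n.

Definition padic_dot (x y : V) : Qp := \sum_(j < n) x 0 j * y 0 j.

Definition padic_vnorm (x : V) : rat := \big[Num.max/0]_(j < n) padic_norm (x 0 j).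

Definition padic_borel := g_sigma_algebraType (@open V).

(* These two conditions determine mu, and make it finite on compact sets. *)
Definition is_haar (mu : {measure set padic_borel -> \bar R}) : Prop :=
  (forall (a : V) (E : set padic_borel), measurable E ->
     mu [set a + x | x in E] = mu E) /\
  mu [set x | padic_vnorm x <= 1] = 1%E.

Definition bruhat_schwartz (phi : V -> C) : Prop :=
  (forall x, \forall y \near x, phi y = phi x) /\
  compact (closure [set x | phi x != 0]).

Definition lc_away0 (a : V -> C) : Prop :=
  forall x : V, x != 0 -> \forall y \near x, a y = a x.

Variable mu : {measure set padic_borel -> \bar R}.

Definition fourier (phi : V -> C) (xi : V) : C :=
  cintegral mu (fun x => padic_char (padic_dot xi x) * phi x).

Definition inv_fourier (psi : V -> C) (x : V) : C :=
  cintegral mu (fun xi => padic_char (- padic_dot xi x) * psi xi).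

(* The Lizorkin test functions of the first (Psi) and second (Phi) kind. *)
Definition Psi : set (V -> C) := [set psi | bruhat_schwartz psi /\ psi 0 = 0].

Definition Phi : set (V -> C) := fourier @` Psi.

(* The functions supported in the ball of radius p^N and invariant under
   translations by the ball of radius p^l. Convergence of sequences of test
   functions is uniform convergence at fixed N and l. Since the test functions
   form the strict inductive limit of these finite-dimensional levels,
   sequential continuity of a linear functional is its continuity. *)
Definition bs_level (N l : int) (phi : V -> C) : Prop :=
  (forall x, p%:R ^ N < padic_vnorm x -> phi x = 0) /\
  (forall x h, padic_vnorm h <= p%:R ^ l -> phi (x + h) = phi x).

Definition bs_cvg (u : nat -> V -> C) (phi : V -> C) : Prop :=
  (exists N l, bs_level N l phi /\ forall k, bs_level N l (u k)) /\
  {uniform, u @ \oo --> phi}.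

Definition lizorkin_distribution (f : (V -> C) -> C) : Prop :=
  (forall a phi psi, Phi phi -> Phi psi ->
     f (fun x => a * phi x + psi x) = a * f phi + f psi) /\
  (forall u phi, (forall k, Phi (u k)) -> Phi phi -> bs_cvg u phi ->
     (fun k => f (u k)) @ \oo --> f phi).

(* f(tx), paired with phi. *)
Definition dilate (f : (V -> C) -> C) (t : Qp) (phi : V -> C) : C :=
  (ratr (padic_norm t) ^- n)%:C * f (fun x => phi (t^-1 *: x)).

(* f ~ g with respect to rho; the first clause says that g is not the zero
   functional on Phi. *)
Definition quasi_asymptotic (f g : (V -> C) -> C) (rho : Qp -> C) : Prop :=
  (exists2 phi, Phi phi & g phi != 0) /\
  (forall phi, Phi phi ->
     (fun t => dilate f t phi / rho t) @ padic_infty --> g phi).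

Definition homogeneous_symbol (a : V -> C) (chi : Qp -> C) : Prop :=
  forall (t : Qp) (xi : V), t != 0 -> xi != 0 -> a (t *: xi) = chi t * a xi.

(* The value of the symbol at 0 is irrelevant, as fourier phi vanishes there for
   phi in Phi. *)
Definition pdo_transpose (a : V -> C) (phi : V -> C) : V -> C :=
  inv_fourier (fun xi => a (- xi) * fourier phi xi).

Definition pdo (a : V -> C) (f : (V -> C) -> C) : (V -> C) -> C :=
  fun phi => f (pdo_transpose a phi).

End PadicAnalysis.

(* Main.v *)
Require Import Defs.
From mathcomp Require Import all_boot all_order all_algebra complex finmap.
From mathcomp Require Import all_classical all_reals all_analysis measurable_realfun.
From mathcomp Require Import zify ring.

(* Let [B_l] be the ball of radius [p ^ l] around 0. A test function is a finite
   combination of indicators of translates of one [B_l], and on these everything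
   is explicit: since a character which is nontrivial on [B_l] has integral zero
   over it, the Fourier transform of the indicator of [a + B_l] is
   [chi(xi a) vol(B_l)] on [B_(-l)] and 0 elsewhere. As [vol(B_l) vol(B_(-l)) = 1],
   applying F twice is the reflection, so that the transposed operator is
   conjugated by F to the multiplication of Psi by the symbol A: it is a
   bijection of Phi because A has no zeros. Dilations are conjugated to dilations
   up to a factor which depends on [l] and [t] only, so homogeneity of A lets the
   operator commute with the dilation by t up to [pi_beta(t)^-1]. The quotients
   defining the two asymptotics thus agree for every t <> 0, with the test
   function moved by that bijection. *)

Set Implicit Arguments.
Unset Strict Implicit.
Unset Printing Implicit Defensive.

Import Order.TTheory GRing.Theory Num.Theory.
Import numFieldNormedType.Exports.

Local Open Scope classical_set_scope.
Local Open Scope ring_scope.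

(** * Norm values, Z[1/p] and leading digits of p-adic numbers *)

Section PadicNumbers.
Variables (p : nat) (p_pr : prime p).
Local Notation Qp := (padic p_pr).
Local Notation P := (p%:R : rat).

Lemma p_gt1 : 1 < P. Proof. by rewrite ltr1n prime_gt1. Qed.
Lemma p_gt0 : 0 < P. Proof. exact: lt_trans p_gt1. Qed.
Lemma p_neq0 : P != 0. Proof. exact: lt0r_neq0 p_gt0. Qed.
Lemma exprz_p_gt0 (k : int) : 0 < P ^ k. Proof. exact: exprz_gt0 p_gt0. Qed.
Lemma exprz_p_ge0 (k : int) : 0 <= P ^ k. Proof. exact: ltW (exprz_p_gt0 k). Qed.

Lemma padic_p_neq0 : (p%:R : Qp) != 0.
Proof. by rewrite -padic_norm_eq0 padic_norm_p invr_eq0 p_neq0. Qed.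

Lemma padic_normV (x : Qp) : padic_norm x^-1 = (padic_norm x)^-1.
Proof.
have [->|x0] := eqVneq x 0; first by rewrite invr0 padic_norm0 invr0.
have nx : padic_norm x != 0 by rewrite padic_norm_eq0.
by apply: (mulIf nx); rewrite -padic_normM !mulVf // padic_norm1.
Qed.

Lemma padic_norm_exprzp (k : int) : padic_norm ((p%:R : Qp) ^ k) = P ^ (- k).
Proof.
have nat_case (i : nat) : padic_norm ((p%:R : Qp) ^+ i) = P ^- i.
  elim: i => [|i IH]; first by rewrite !expr0 padic_norm1 invr1.
  by rewrite exprS padic_normM IH padic_norm_p [in RHS]exprS invfM.
case: k => i; first by rewrite -exprnP nat_case exprnN.
by rewrite NegzE opprK -exprnN -exprnP padic_normV nat_case invrK.
Qed.

(** The norm of [x] is already attained by a rational far along its Cauchy sequence, and rational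
    norms are powers of p. *)
Lemma padic_norm_value (x : Qp) : x != 0 -> exists k : int, padic_norm x = P ^ k.
Proof.
move=> x0; have [K hK] := padic_norm_repr x0.
have := hK K (leqnn _); rewrite /rat_padic_norm; case: eqP => _ h.
  by have := padic_norm_gt0 x0; rewrite -h ltxx.
by eexists; rewrite -h.
Qed.

Lemma padic_norm_discrete (x : Qp) (k : int) :
  padic_norm x < P ^ (k + 1) -> padic_norm x <= P ^ k.
Proof.
have [->|/padic_norm_value[m ->]] := eqVneq x 0.
  by rewrite padic_norm0 exprz_p_ge0.
by rewrite ltr_eXz2l ?p_gt1 // ler_eXz2l ?p_gt1 //; lia.
Qed.

Lemma exprz_p_below (e : rat) : 0 < e -> exists k : int, P ^ k < e.
Proof.
move=> e0; pose b := Num.bound e^-1; exists (- b%:Z).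
rewrite -exprnN -[ltRHS]invrK ltf_pV2 ?posrE ?invr_gt0 ?exprn_gt0 ?p_gt0 //.
have ve0 : 0 <= e^-1 by rewrite invr_ge0 ltW.
apply: lt_trans (archi_boundP ve0) _.
by rewrite -natrX ltr_nat ltn_expl ?prime_gt1.
Qed.

(** Membership in Z[1/p], the second condition in [padic_frac_of]. *)
Definition p_integral (q : rat) : Prop := exists k : nat, q * P ^+ k \is a Num.int.

Lemma p_integralD q r : p_integral q -> p_integral r -> p_integral (q + r).
Proof.
move=> [k hk] [m hm]; exists (k + m)%N.
rewrite exprD mulrDl mulrA [r * _]mulrCA rpredD // rpredM //.
  by rewrite rpredX // rpred_nat.
by rewrite rpredX // rpred_nat.
Qed.

Lemma p_integralN q : p_integral q -> p_integral (- q).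
Proof. by move=> [k hk]; exists k; rewrite mulNr rpredN. Qed.

(** Z[1/p] meets the p-adic unit ball in Z: the bound on the norm forces p^k to divide the numerator
    over p^k. *)
Lemma p_integral_int q :
  p_integral q -> rat_padic_norm p q <= 1 -> q \is a Num.int.
Proof.
move=> [k /intrP[z qz]] q1.
have Pk0 : P ^+ k != 0 by rewrite expf_neq0 // p_neq0.
have : ((p ^ k)%N%:Z %| z)%Z.
  rewrite -(rat_padic_norm_int_le p_pr) -qz rat_padic_normM //.
  have -> : rat_padic_norm p (P ^+ k) = P ^- k.
    rewrite -natrX [_%:R]pmulrn (rat_padic_norm_int p_pr) /=; last first.
      by rewrite gt_eqF // ltz_nat expn_gt0 prime_gt0.
    by rewrite pfactorK // -pmulrn natrX.
  by rewrite ler_piMl // invr_ge0 exprn_ge0 // ltW // p_gt0.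
move=> /dvdzP[y zy]; apply/intrP; exists y; apply: (mulIf Pk0).
by rewrite qz zy rmorphM /= -pmulrn natrX.
Qed.

Lemma padic_digit_uniq (d e : 'I_p) :
  padic_norm ((d%:R : Qp) - e%:R) <= P^-1 -> d = e.
Proof.
have -> : (d%:R : Qp) - e%:R = (d%:Z - e%:Z)%:~R by rewrite rmorphB /= -!pmulrn.
rewrite padic_norm_int (_ : P^-1 = P ^- 1) // (rat_padic_norm_int_le p_pr) expn1.
move=> /dvdzP[q hq]; apply/val_inj => /=.
have := ltn_ord d; have := ltn_ord e; have := prime_gt0 p_pr => p0.
(* A nonzero [q] would give [|d - e| >= p], while both digits lie in [0, p[. *)
have [||q0] := ltgtP q 0; [nia|nia|].
by move: hq; rewrite q0; lia.
Qed.

Lemma padic_ratrD (q r : rat) : ratr (q + r) = ratr q + ratr r :> Qp.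
Proof.
have ratrN (a : rat) : ratr (- a) = - ratr a :> Qp.
  by rewrite -sub0r padic_ratrB -(subrr a) padic_ratrB subrr sub0r.
by rewrite -[r in LHS]opprK padic_ratrB ratrN opprK.
Qed.

Lemma padic_ratrMn (q : rat) m : ratr (q *+ m) = ratr q *+ m :> Qp.
Proof.
elim: m => [|m IH]; first by rewrite !mulr0n -(subrr q) padic_ratrB subrr.
by rewrite !mulrS padic_ratrD IH.
Qed.

(** The digit is p times the fractional part of x/p. This is an integer because it lies in Z[1/p]
    and has norm at most 1, and it lies in [0, p[ because the fractional part lies in [0, 1[. *)
Lemma padic_digit (x : Qp) : padic_norm x <= 1 ->
  exists d : 'I_p, padic_norm (x - d%:R) <= P^-1.
Proof.
move=> x1; have [q [/andP[q0 q1] [k qk] xq]] := padic_frac_ex (x / p%:R).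
have nxp : padic_norm (x / p%:R) <= P.
  have := padic_norm_exprzp (- 1); rewrite opprK expr1z exprN1 => pV.
  by rewrite padic_normM pV ler_piMl // ltW // p_gt0.
have nq : rat_padic_norm p q <= P.
  rewrite -(padic_norm_ratr p_pr) -[ratr q](subKr (x / p%:R)).
  apply: le_trans (padic_normD _ _) _; rewrite ge_max nxp padic_normN.
  by rewrite (le_trans xq) // ltW // p_gt1.
have /intrP[z pqz] : P * q \is a Num.int.
  apply: p_integral_int; first by exists k; rewrite -mulrA rpredM // rpred_nat.
  rewrite rat_padic_normM // -(padic_norm_ratr p_pr P) ratr_nat padic_norm_p.
  by rewrite mulrC ler_pdivrMr ?p_gt0 // mul1r.
have z0 : 0 <= z by rewrite -(ler0z rat) -pqz mulr_ge0 // ltW // p_gt0.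
have zp : (`|z| < p)%N.
  by rewrite -(ltr_nat rat) natr_absz ger0_norm // -pqz -[ltRHS]mulr1 ltr_pM2l ?p_gt0.
exists (Ordinal zp) => /=.
have -> : (`|z|%N%:R : Qp) = p%:R * ratr q.
  rewrite mulr_natl -padic_ratrMn -[q *+ _]mulr_natl pqz ratr_int.
  by rewrite pmulrn (gez0_abs z0).
have {1}-> : x = p%:R * (x / p%:R) by rewrite mulrC divfK // padic_p_neq0.
rewrite -mulrBr padic_normM padic_norm_p ler_piMr // invr_ge0 ltW //.
Qed.

End PadicNumbers.

(** * Balls of Q_p^n, their decomposition into cosets, and step functions *)

Section Balls.
Variables (p : nat) (p_pr : prime p) (n : nat).
Local Notation Qp := (padic p_pr).
Local Notation P := (p%:R : rat).
Local Notation V := 'rV[Qp]_n.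

Definition pball (l : int) : set V := [set x | padic_vnorm x <= P ^ l].

Lemma pballP l x : pball l x <-> forall j, padic_norm (x 0 j) <= P ^ l.
Proof.
rewrite /pball/= /padic_vnorm; split=> [/bigmax_leP[_ h] j|h]; first exact: h.
by apply/bigmax_leP; split=> //; exact: exprz_p_ge0.
Qed.

Lemma pball0 l : pball l 0.
Proof. by apply/pballP => j; rewrite mxE padic_norm0 exprz_p_ge0. Qed.

Lemma pballN l x : pball l (- x) <-> pball l x.
Proof.
by split=> /pballP h; apply/pballP => j; have := h j; rewrite mxE padic_normN.
Qed.

Lemma pballD l x y : pball l x -> pball l y -> pball l (x + y).
Proof.
move=> /pballP hx /pballP hy; apply/pballP => j; rewrite mxE.
by apply: le_trans (padic_normD _ _) _; rewrite ge_max hx hy.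
Qed.

Lemma pballDr l x y : pball l y -> pball l (x + y) <-> pball l x.
Proof.
move=> hy; split=> [h|hx]; last exact: pballD.
by rewrite -(addrK y x); apply: pballD => //; apply/pballN.
Qed.

Lemma pballW l l' x : l <= l' -> pball l x -> pball l' x.
Proof.
move=> ll'; rewrite /pball/= => /le_trans; apply.
by rewrite ler_eXz2l ?p_gt1.
Qed.

Lemma pballZ l k t x : padic_norm t = P ^ k -> pball l x -> pball (l + k) (t *: x).
Proof.
move=> tk /pballP h; apply/pballP => j; rewrite mxE padic_normM tk mulrC.
by rewrite expfzDr ?p_neq0 // ler_pM2r ?exprz_p_gt0.
Qed.

Lemma pballZE l k t x : padic_norm t = P ^ k ->
  pball (l + k) (t *: x) <-> pball l x.
Proof.
move=> tk; split=> [h|]; last exact: pballZ.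
have t0 : t != 0 by rewrite -padic_norm_eq0 tk gt_eqF // exprz_p_gt0.
have tVk : padic_norm t^-1 = P ^ (- k).
  by rewrite padic_normV tk invr_expz.
by have := pballZ tVk h; rewrite scalerA mulVf // scale1r addrK.
Qed.

Lemma pball_exists x : exists l, pball l x.
Proof.
have [x0|x0] := leP (padic_vnorm x) 0.
  by exists 0; rewrite /pball/= (le_trans x0).
have vx0 : 0 < (padic_vnorm x)^-1 by rewrite invr_gt0.
have [k hk] := exprz_p_below p_pr vx0.
exists (- k); rewrite /pball/= -invr_expz -[leLHS]invrK.
by rewrite lef_pV2 ?posrE ?invr_gt0 ?exprz_p_gt0 // ltW.
Qed.

Lemma nbhs_pball (x : V) (S : set V) :
  nbhs x S <-> exists l, forall h, pball l h -> S (x + h).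
Proof.
split=> [/nbhs_ballP[e /= e0 hS]|[l hl]].
  have [k ke] := exprz_p_below p_pr e0; exists k => h /pballP hk.
  apply: hS; split=> // i j; rewrite (ord1 i) /ball /= /padic_dist mxE opprD addNKr.
  by rewrite padic_normN; apply: le_lt_trans (hk j) ke.
apply/nbhs_ballP; exists (P ^ l) => /=; first exact: exprz_p_gt0.
move=> y [_ hy]; rewrite -(subrKC x y); apply: hl; apply/pballP => j.
have := hy 0 j; rewrite /ball /= /padic_dist => /ltW.
by rewrite !mxE -padic_normN opprB.
Qed.

Lemma open_pball l a : open [set x | pball l (x - a)].
Proof.
rewrite openE => x xa; apply/nbhs_pball; exists l => h hl /=.
by rewrite addrAC pballDr.
Qed.

(** Representatives of the cosets of B_l in B_(l+1): vectors of B_(l+1) have coordinates in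
    p^(-(l+1)) Z_p, and their leading digits determine the coset. *)
Definition digit_vector (l : int) (d : {ffun 'I_n -> 'I_p}) : V :=
  \row_j ((p%:R : Qp) ^ (- (l + 1)) * (d j)%:R).

Lemma digit_vectorB l x (d : {ffun 'I_n -> 'I_p}) :
  pball l (x - digit_vector l d) <->
  forall j, padic_norm (p%:R ^ (l + 1) * x 0 j - (d j)%:R) <= P^-1.
Proof.
have E j : padic_norm ((x - digit_vector l d) 0 j) =
    P ^ (l + 1) * padic_norm (p%:R ^ (l + 1) * x 0 j - (d j)%:R).
  have p0 := padic_p_neq0 p_pr.
  rewrite !mxE -[in P ^ _](opprK (l + 1)) -(padic_norm_exprzp p_pr) -padic_normM.
  by rewrite mulrBr mulrA -expfzDr // addNr expr0z mul1r.
have E' r : (P ^ (l + 1) * r <= P ^ l) = (r <= P^-1).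
  have -> : P ^ l = P ^ (l + 1) * P^-1.
    by rewrite -exprN1 -expfzDr ?p_neq0 // addrK.
  by rewrite ler_pM2l ?exprz_p_gt0.
split=> [/pballP h j|h].
  by have := h j; rewrite E E'.
by apply/pballP => j; rewrite E E'.
Qed.

Lemma pball_digit_vector l d : pball (l + 1) (digit_vector l d).
Proof.
apply/pballP => j; rewrite mxE padic_normM padic_norm_exprzp opprK.
rewrite ler_piMr ?exprz_p_ge0 // -(rmorph_nat (intr : int -> Qp)) /=.
rewrite padic_norm_int -[1]invr1 -[X in _ <= X^-1](expr0 P).
by rewrite (rat_padic_norm_int_le p_pr) expn0 dvd1z.
Qed.

Variable C : numFieldType.

(** Indicator of B_l. The codomain is a parameter: real values serve for the measure, complex ones
    for test functions. *)
Definition pind (l : int) (x : V) : C := (padic_vnorm x <= P ^ l)%R%:R.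

Lemma pindE l x : pball l x -> pind l x = 1.
Proof. by rewrite /pball/= /pind => ->. Qed.

Lemma pindN l x : ~ pball l x -> pind l x = 0.
Proof. by move=> /negP/negPf; rewrite /pind => ->. Qed.

(** B_(l+1) is the disjoint union of the cosets of B_l given by the digit vectors: the leading
    digits of the coordinates select exactly one. *)
Lemma pind_digits l x : pind (l + 1) x = \sum_d pind l (x - digit_vector l d).
Proof.
have [hx|hx] := pselect (pball (l + 1) x); last first.
  rewrite pindN // big1 // => d _; rewrite pindN // => h; apply: hx.
  rewrite -(subrK (digit_vector l d) x); apply: pballD.
    by apply: pballW h; rewrite lerDl.
  exact: pball_digit_vector.
have /choice[d hd] : forall j, exists d : 'I_p,
    padic_norm (p%:R ^ (l + 1) * x 0 j - d%:R) <= P^-1.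
  move=> j; apply: padic_digit; rewrite padic_normM padic_norm_exprzp.
  rewrite -invr_expz mulrC ler_pdivrMr ?exprz_p_gt0 // mul1r.
  exact: (pballP _ _).1.
have hb : pball l (x - digit_vector l (finfun d)).
  by apply/digit_vectorB => j; rewrite ffunE.
rewrite (bigD1 (finfun d)) //= !pindE // big1 ?addr0 // => e ed.
rewrite pindN // => /digit_vectorB he; move/eqP: ed; apply.
apply/ffunP => j; rewrite ffunE; apply: (@padic_digit_uniq _ p_pr).
set y := p%:R ^ (l + 1) * x 0 j in hd he *.
(* By the ultrametric inequality, two digits within 1/p of the same [y] are within 1/p of each
   other. *)
have -> : (e j)%:R - (d j)%:R = (y - (d j)%:R) - (y - (e j)%:R).
  by rewrite opprB [RHS]addrC addrA subrK.
apply: le_trans (padic_normD _ _) _; rewrite ge_max padic_normN.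
by rewrite he /y hd.
Qed.

(** Induction on [l - l'], splitting each ball into its p^n cosets one level below. *)
Lemma pball_cover l l' : l' <= l -> exists s : seq V,
  forall x, pball l x -> exists2 a, a \in s & pball l' (x - a).
Proof.
move=> ll'; have -> : l = l' + `|l - l'|%N by lia.
elim: `|_|%N => [|k [s hs]].
  by exists [:: 0] => x; rewrite addr0 => hx; exists 0; rewrite ?inE ?subr0.
exists [seq a + digit_vector (l' + k) d | d <- enum {ffun 'I_n -> 'I_p}, a <- s].
move=> x; have -> : l' + k.+1%:Z = (l' + k%:Z) + 1 by lia.
(* The sum over digit vectors equals 1 here, so its terms cannot all vanish; a nonzero one is a
   coset containing [x]. *)
move=> hx; have := pind_digits (l' + k) x; rewrite pindE //.
have [[d hd] _|no] :=
    pselect (exists d, pball (l' + k) (x - digit_vector (l' + k) d)).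
  have [a as_ ha] := hs _ hd; exists (a + digit_vector (l' + k) d).
    by apply/allpairsP; exists (d, a); rewrite mem_enum.
  by rewrite opprD addrCA addrC.
rewrite big1 => [/eqP|d _]; first by rewrite oner_eq0.
by rewrite pindN // => h; apply: no; exists d.
Qed.

(* D(Q_p^n) at level l, with compactness of the support expressed by finitely
   many cosets of the ball. *)
Definition step (l : int) (h : V -> C) : Prop :=
  (forall x k, pball l k -> h (x + k) = h x) /\
  exists s : seq V, forall x, h x != 0 -> exists2 a, a \in s & pball l (x - a).

Lemma step_mul l h u : step l h ->
  (forall x k, pball l k -> u (x + k) = u x) -> step l (fun x => u x * h x).
Proof.
move=> [hi [s hs]] ui; split=> [x k lk|]; first by rewrite hi ?ui.
by exists s => x /eqP ux0; apply: hs; apply: contra_notN ux0 => /eqP->; rewrite mulr0.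
Qed.

Lemma stepZ l h c : step l h -> step l (fun x => c * h x).
Proof. by move=> hh; apply: (step_mul (u := fun=> c) hh). Qed.

Lemma step0 l : step l (fun=> 0).
Proof. by split=> //; exists [::] => x; rewrite eqxx. Qed.

Lemma step_translate l h a : step l h -> step l (fun x => h (x - a)).
Proof.
move=> [hi [s hs]]; split=> [x k lk|]; first by rewrite addrAC (hi (x - a)).
exists [seq b + a | b <- s] => x /hs[b sb hb]; exists (b + a); first exact: map_f.
by rewrite [b + a]addrC opprD addrA.
Qed.

Lemma step_pind l : step l (pind l).
Proof.
split=> [x k lk|].
  have [hx|hx] := pselect (pball l x); first by rewrite !pindE //; apply: pballD.
  by rewrite !pindN // pballDr.
exists [:: 0] => x; have [hx _|hx] := pselect (pball l x).
  by exists 0; rewrite ?inE ?subr0.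
by rewrite pindN // eqxx.
Qed.

Lemma step_refine l l' h : l' <= l -> step l h -> step l' h.
Proof.
move=> ll' [hi [s hs]]; split=> [x k lk|].
  by apply: hi; apply: pballW lk.
have [t ht] := pball_cover ll'.
exists [seq a + b | a <- s, b <- t] => x /hs[a sa /ht[b tb hb]].
exists (a + b); first by apply/allpairsP; exists (a, b).
by rewrite opprD addrA.
Qed.

(** Peel off one coset at a time: subtracting [h a] times the indicator of a + B_l removes this
    coset from the support. *)
Lemma step_sum l h : step l h -> exists s : seq (C * V),
  h = fun x => \sum_(c <- s) c.1 * pind l (x - c.2).
Proof.
move=> [hi [s hs]]; elim: s h hi hs => [|a s IH] h hi hs.
  exists [::]; apply/funext => x; rewrite big_nil.
  by apply/eqP; apply: contraT => /hs[].
pose u x := h x - h a * pind l (x - a).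
have [ui _] : step l (fun x => h a * pind l (x - a)).
  exact/stepZ/step_translate/step_pind.
have [||t ht] := IH u.
- by move=> x k lk; rewrite /u hi // ui.
(* The subtraction creates no new support: if [h x = 0] with [x] in the coset of [a], then [h a = 0]
   as well. *)
- move=> x ux0; have hx0 : h x != 0.
    apply: contra_neq ux0 => hx0; rewrite /u hx0.
    have [xa|xa] := pselect (pball l (x - a)); last by rewrite pindN // mulr0 subr0.
    by rewrite -(hi a (x - a)) // subrKC hx0 mul0r subr0.
  have [b] := hs x hx0; rewrite inE => /orP[/eqP-> xa|]; last by exists b.
  by move: ux0; rewrite /u pindE // mulr1 -(hi a (x - a)) // subrKC subrr eqxx.
exists ((h a, a) :: t); apply/funext => x; rewrite big_cons /=.
by have := congr1 (fun f => f x) ht; rewrite /u /= => <-; rewrite subrKC.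
Qed.

End Balls.

(** * The additive character of Q_p *)

Section Character.
Local Open Scope complex_scope.
Variables (R : realType) (p : nat) (p_pr : prime p).
Local Notation C := R[i].
Local Notation Qp := (padic p_pr).
Local Notation P := (p%:R : rat).

Definition expi2pi (q : rat) : C := cexp (0 +i* (2 * pi * ratr q)).

Lemma expi2piD q r : expi2pi (q + r) = expi2pi q * expi2pi r.
Proof.
rewrite /expi2pi /cexp /= expR0 !mul1r rmorphD mulrDr cosD sinD.
by apply/eqP; rewrite eq_complex /= eqxx /= addrC.
Qed.

Lemma expi2pi0 : expi2pi 0 = 1.
Proof. by rewrite /expi2pi /cexp /= expR0 !mul1r rmorph0 mulr0 cos0 sin0. Qed.

Lemma expi2pi_nat k : expi2pi k%:R = 1.
Proof.
elim: k => [|k IH]; first exact: expi2pi0.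
rewrite -addn1 natrD expi2piD IH mul1r /expi2pi /cexp /= expR0 !mul1r rmorph1.
by rewrite mulr1 mulr_natl cos2pi sin2pi.
Qed.

Lemma expi2pi_int q : q \is a Num.int -> expi2pi q = 1.
Proof.
move=> /intrP[[k|k] ->]; first exact: expi2pi_nat.
rewrite NegzE mulrNz -[LHS]mulr1 -[X in _ * X](expi2pi_nat k.+1) -expi2piD.
by rewrite addNr expi2pi0.
Qed.

(** Two elements of Z[1/p] congruent to [x] modulo Z_p differ by an integer, which the exponential
    ignores; the fractional part may thus be replaced by any such representative. This makes
    additivity easy. *)
Lemma padic_char_eq (x : Qp) q : p_integral p q -> padic_norm (x - ratr q) <= 1 ->
  padic_char R x = expi2pi q.
Proof.
move=> qp xq; rewrite /padic_char; set r := padic_frac x.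
have [_ rp xr] : padic_frac_of x r by apply: getPex; exact: padic_frac_ex.
rewrite -/(expi2pi r) -[r](subrK q) expi2piD [X in X * _]expi2pi_int ?mul1r //.
apply: (p_integral_int p_pr); first exact/p_integralD/p_integralN.
rewrite -(padic_norm_ratr p_pr) padic_ratrB -(subrKA x).
apply: le_trans (padic_normD _ _) _; rewrite ge_max xq andbT.
by rewrite -padic_normN opprB.
Qed.

Lemma padic_char_small (x : Qp) : padic_norm x <= 1 -> padic_char R x = 1.
Proof.
move=> x1; rewrite (@padic_char_eq x 0) ?expi2pi0 //.
  by exists 0%N; rewrite mul0r rpred0.
by rewrite -(subrr (0 : rat)) padic_ratrB subrr subr0.
Qed.

Lemma padic_charD (x y : Qp) :
  padic_char R (x + y) = padic_char R x * padic_char R y.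
Proof.
have charE (z : Qp) : exists q, [/\ p_integral p q, padic_norm (z - ratr q) <= 1
    & padic_char R z = expi2pi q].
  have [q [_ qp zq]] := padic_frac_ex z.
  by exists q; split=> //; exact: padic_char_eq.
have [q [qp xq ->]] := charE x; have [r [rp yr ->]] := charE y.
rewrite -expi2piD; apply: padic_char_eq; first exact: p_integralD.
have -> : x + y - ratr (q + r) = (x - ratr q) + (y - ratr r).
  by rewrite padic_ratrD opprD addrACA.
by apply: le_trans (padic_normD _ _) _; rewrite ge_max xq yr.
Qed.

Lemma padic_charV_neq1 : padic_char R (p%:R^-1 : Qp) != 1.
Proof.
rewrite (@padic_char_eq _ P^-1); first last.
- rewrite (_ : ratr P^-1 = p%:R^-1) ?subrr ?padic_norm0 //.
  have p0 := padic_p_neq0 p_pr; apply: (mulfI p0); rewrite mulfV //.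
  rewrite mulr_natl; have /esym := padic_ratrMn p_pr P^-1 p.
  by rewrite -[P^-1 *+ p]mulr_natr mulVf ?p_neq0 // (ratr_nat _ 1).
- by exists 1%N; rewrite expr1 mulVf ?p_neq0 // rpred1.
have -> : expi2pi P^-1 = cexp (0 +i* (2 * pi * p%:R^-1)).
  have pV : ratr P^-1 = p%:R^-1 :> R by rewrite fmorphV /= ratr_nat.
  by rewrite /expi2pi pV.
rewrite /cexp /= expR0 !mul1r; apply/eqP => /(congr1 (@complex.Re R)) /=.
have p2 : 2 <= p%:R :> R by rewrite ler_nat prime_gt1.
have p0 : 0 < p%:R :> R by rewrite (lt_le_trans _ p2).
(* Since p >= 2, the angle 2 pi / p lies in [0, pi], where the cosine is injective; so it cannot
   share its cosine with 0. *)
rewrite -[X in _ = X -> _](cos0 R) => /(@cos_inj R) /eqP.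
have pi0 := pi_gt0 R.
rewrite !in_itv/= lexx pi_ge0 mulr_ge0 ?mulr_ge0 ?pi_ge0 ?invr_ge0 ?ler0n //=.
rewrite ler_pdivrMr // mulrC ler_pM2l // p2 => /(_ isT isT).
by rewrite !mulf_eq0 invr_eq0 !gt_eqF.
Qed.

End Character.

(** * Haar volumes of balls and integrals of combinations of their indicators *)

Section Haar.
Local Open Scope complex_scope.
Variables (R : realType) (p : nat) (p_pr : prime p) (n : nat).
Local Notation C := R[i].
Local Notation Qp := (padic p_pr).
Local Notation V := 'rV[Qp]_n.
Variable mu : {measure set (padic_borel p_pr n) -> \bar R}.

Lemma measurable_pball l (a : V) :
  measurable ([set x | pball l (x - a)] : set (padic_borel p_pr n)).
Proof. by apply: sub_sigma_algebra; exact: open_pball. Qed.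

Lemma measurable_pball0 l : measurable (pball l : set (padic_borel p_pr n)).
Proof.
have := measurable_pball l 0.
by rewrite (_ : [set x | _] = pball l) //; apply/funext => x; rewrite /= subr0.
Qed.

Lemma indic_pball l (a : V) :
  \1_[set y | pball l (y - a)] = (fun x => pind R l (x - a)) :> (V -> R).
Proof.
apply/funext => x; rewrite indicE; case: (boolP (_ \in _)) => [|] /=.
  by rewrite inE /= => /pindE->.
by move=> /negP h; rewrite pindN // => h'; apply: h; rewrite inE.
Qed.

Hypothesis mu_haar : is_haar mu.

Lemma haar_pball l (a : V) : mu [set x | pball l (x - a)] = mu (pball l).
Proof.
rewrite -(mu_haar.1 a _ (measurable_pball0 l)); congr (mu _); apply/seteqP; split.
  by move=> x /= hx; exists (x - a); rewrite // subrKC.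
by move=> _ [x hx <-] /=; rewrite addrC addKr.
Qed.

(** The index p^n of B_l in B_(l+1), as the number of digit vectors. *)
Definition pball_index : R := #|{ffun 'I_n -> 'I_p}|%:R.

Lemma pball_index_gt0 : 0 < pball_index.
Proof. by rewrite ltr0n card_ffun !card_ord expn_gt0 prime_gt0. Qed.

Lemma haar_pballS l : mu (pball (l + 1)) = (pball_index%:E * mu (pball l))%E.
Proof.
rewrite -(haar_pball (l + 1) 0) -[X in mu X]setIT -integral_indic //; last first.
  exact: measurable_pball.
transitivity (\int[mu]_x (\sum_(d : {ffun 'I_n -> 'I_p})
    (\1_[set y | pball l (y - digit_vector p_pr l d)] x)%:E))%E.
  apply: eq_integral => x _; rewrite sumEFin indic_pball subr0 pind_digits.
  by congr (_%:E); apply: eq_bigr => d _; rewrite indic_pball.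
rewrite ge0_integral_sum //; last first.
  move=> d; apply/measurable_EFinP; apply: measurable_indic; exact: measurable_pball.
rewrite (eq_bigr (fun=> mu (pball l))) => [|d _]; last first.
  by rewrite integral_indic ?setIT ?haar_pball //; exact: measurable_pball.
by rewrite sumr_const mule_natl cardT -cardE.
Qed.

(** Starting from the normalisation of B_0, the index relation between consecutive balls is followed
    upwards and downwards. *)
Lemma haar_pball_value l : mu (pball l) = (pball_index ^ l)%:E.
Proof.
have M0 := pball_index_gt0; have Mn0 := lt0r_neq0 M0.
have up k : mu (pball k) = (pball_index ^ k)%:E ->
    mu (pball (k + 1)) = (pball_index ^ (k + 1))%:E.
  by move=> hk; rewrite haar_pballS hk -EFinM mulrC expfzDr.
have down k : mu (pball (k + 1)) = (pball_index ^ (k + 1))%:E ->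
    mu (pball k) = (pball_index ^ k)%:E.
  (* Going down, an infinite volume of the smaller ball has to be excluded: it would make the larger
     one infinite. *)
  rewrite haar_pballS; case: (mu (pball k)) => [r||]; last 2 first.
  - by rewrite gt0_muley ?lte_fin.
  - by rewrite gt0_muleNy ?lte_fin.
  rewrite -EFinM => -[] h; congr (_%:E); apply: (mulfI Mn0).
  by rewrite h expfzDr // mulrC.
have base : mu (pball 0) = (pball_index ^ 0)%:E.
  by rewrite expr0z -mu_haar.2 /pball expr0z.
elim/int_ind: l => // k IH.
  by have := up _ IH; rewrite (_ : k%:Z + 1 = k.+1%:Z) //; lia.
by apply: down; move: IH; rewrite (_ : - k%:Z = - k.+1%:Z + 1) //; lia.
Qed.

Definition pball_vol l : C := (pball_index ^ l)%:C.

Lemma pball_volN l : pball_vol l * pball_vol (- l) = 1.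
Proof.
by rewrite /pball_vol -rmorphM -expfzDr ?subrr ?gt_eqF ?pball_index_gt0.
Qed.

Lemma pball_vol_neq0 l : pball_vol l != 0.
Proof.
by apply: contra_eq_neq (pball_volN l) => ->; rewrite mul0r eq_sym oner_eq0.
Qed.

Definition cintegrable (f : V -> C) : Prop :=
  mu.-integrable setT (EFin \o (fun x => complex.Re (f x))) /\
  mu.-integrable setT (EFin \o (fun x => complex.Im (f x))).

Lemma cintegralD f g : cintegrable f -> cintegrable g ->
  cintegral mu (fun x => f x + g x) = cintegral mu f + cintegral mu g.
Proof.
have mT := @measurableT _ (padic_borel p_pr n).
move=> [f1 f2] [g1 g2]; rewrite /cintegral.
have ReD : (fun x => complex.Re (f x + g x)) =
    (fun x => complex.Re (f x) + complex.Re (g x)).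
  by apply/funext => x; case: (f x) (g x) => ? ? [].
have ImD : (fun x => complex.Im (f x + g x)) =
    (fun x => complex.Im (f x) + complex.Im (g x)).
  by apply/funext => x; case: (f x) (g x) => ? ? [].
by rewrite ReD ImD !RintegralD.
Qed.

Lemma cintegrableD f g : cintegrable f -> cintegrable g ->
  cintegrable (fun x => f x + g x).
Proof.
have mT := @measurableT _ (padic_borel p_pr n).
move=> [f1 f2] [g1 g2]; split.
  apply: eq_integrable (integrableD mT f1 g1) => // x _ /=.
  by case: (f x) (g x) => ? ? [].
apply: eq_integrable (integrableD mT f2 g2) => // x _ /=.
by case: (f x) (g x) => ? ? [].
Qed.

Lemma integral_pind l (a : V) (c : R) :
  mu.-integrable setT (EFin \o (fun x => c * pind R l (x - a))) /\
  \int[mu]_x (c * pind R l (x - a)) = c * pball_index ^ l.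
Proof.
have mT := @measurableT _ (padic_borel p_pr n).
pose g (x : V) : R := pind R l (x - a).
have gI : g = \1_[set y | pball l (y - a)] by rewrite indic_pball.
have int1 : (\int[mu]_x (g x)%:E)%E = (pball_index ^ l)%:E.
  rewrite gI integral_indic ?setIT ?haar_pball ?haar_pball_value //.
  exact: measurable_pball.
have pI : mu.-integrable setT (EFin \o g).
  apply/integrableP; split.
    apply/measurable_EFinP; rewrite gI; apply: measurable_indic.
    exact: measurable_pball.
  under eq_integral do rewrite /= ger0_norm ?ler0n //.
  by rewrite int1 ltry.
split; first by apply: eq_integrable (integrableZl mT c pI).
by rewrite (RintegralZl _ mT pI) /Rintegral int1.
Qed.

Lemma cintegral_pind l (a : V) (c : C) :
  cintegrable (fun x => c * pind C l (x - a)) /\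
  cintegral mu (fun x => c * pind C l (x - a)) = c * pball_vol l.
Proof.
have ReE : (fun x : V => complex.Re (c * pind C l (x - a))) =
    (fun x => complex.Re c * pind R l (x - a)).
  by apply/funext => x; rewrite /pind;
     case: (c) => r s; case: (_ <= _) => /=; rewrite ?mulr0 ?mulr1 ?subr0.
have ImE : (fun x : V => complex.Im (c * pind C l (x - a))) =
    (fun x => complex.Im c * pind R l (x - a)).
  by apply/funext => x; rewrite /pind;
     case: (c) => r s; case: (_ <= _) => /=; rewrite ?mulr0 ?mulr1 ?add0r.
have [Re1 Re2] := integral_pind l a (complex.Re c).
have [Im1 Im2] := integral_pind l a (complex.Im c).
split; first by rewrite /cintegrable ReE ImE.
rewrite /cintegral ReE ImE Re2 Im2 /pball_vol.
by case: (c) => r s /=; simpc.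
Qed.

Lemma cintegral_sum l (s : seq (C * V)) :
  cintegrable (fun x => \sum_(c <- s) c.1 * pind C l (x - c.2)) /\
  cintegral mu (fun x => \sum_(c <- s) c.1 * pind C l (x - c.2)) =
    \sum_(c <- s) c.1 * pball_vol l.
Proof.
elim: s => [|c s [IH1 IH2]].
  have E : (fun x : V => \sum_(c <- [::]) c.1 * pind C l (x - c.2)) =
      (fun x => 0 * pind C l (x - 0)).
    by apply/funext => x; rewrite big_nil mul0r.
  have [h1 h2] := cintegral_pind l 0 0.
  by rewrite E; split=> //; rewrite h2 big_nil mul0r.
have [h1 h2] := cintegral_pind l c.2 c.1.
have E : (fun x : V => \sum_(c <- c :: s) c.1 * pind C l (x - c.2)) =
    (fun x => c.1 * pind C l (x - c.2) + \sum_(c <- s) c.1 * pind C l (x - c.2)).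
  by apply/funext => x; rewrite big_cons.
by rewrite E big_cons cintegralD // h2 IH2; split=> //; exact: cintegrableD.
Qed.

End Haar.

(** * Linearity and translation invariance of the integral on step functions *)

Section StepIntegral.
Variables (R : realType) (p : nat) (p_pr : prime p) (n : nat).
Local Notation C := R[i].
Local Notation Qp := (padic p_pr).
Local Notation V := 'rV[Qp]_n.
Variable mu : {measure set (padic_borel p_pr n) -> \bar R}.
Hypothesis mu_haar : is_haar mu.

Lemma step_cintegrable l (h : V -> C) : step l h -> cintegrable mu h.
Proof. by move=> /step_sum[s ->]; exact: (cintegral_sum mu_haar l s).1. Qed.

Lemma step_integralZ l (h : V -> C) c : step l h ->
  cintegral mu (fun x => c * h x) = c * cintegral mu h.
Proof.
move=> /step_sum[s ->].
have -> : (fun x => c * \sum_(d <- s) d.1 * pind C l (x - d.2)) =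
    (fun x => \sum_(d <- [seq (c * d.1, d.2) | d <- s]) d.1 * pind C l (x - d.2)).
  apply/funext => x; rewrite big_map mulr_sumr.
  by apply: eq_bigr => d _; rewrite mulrA.
rewrite !(cintegral_sum mu_haar l _).2 big_map mulr_sumr.
by apply: eq_bigr => d _; rewrite mulrA.
Qed.

(** A translation moves the centres of the cosets, and the integral sees only the coefficients and
    the common volume. *)
Lemma step_integral_translate l (h : V -> C) a : step l h ->
  cintegral mu (fun x => h (x + a)) = cintegral mu h.
Proof.
move=> /step_sum[s ->].
have -> : (fun x => \sum_(d <- s) d.1 * pind C l (x + a - d.2)) =
    (fun x => \sum_(d <- [seq (d.1, d.2 - a) | d <- s]) d.1 * pind C l (x - d.2)).
  apply/funext => x; rewrite big_map.
  by apply: eq_bigr => d _ /=; rewrite opprB addrA.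
by rewrite !(cintegral_sum mu_haar l _).2 big_map.
Qed.

Lemma step_integral_sum (I : Type) (s : seq I) (h : I -> V -> C) :
  (forall i, exists l, step l (h i)) ->
  cintegral mu (fun x => \sum_(i <- s) h i x) = \sum_(i <- s) cintegral mu (h i).
Proof.
move=> hs; pose S r x := \sum_(i <- r) h i x.
(* Integrability of the partial sums is carried along the induction, as additivity requires it. The
   levels of the summands may differ. *)
suff [] : cintegral mu (S s) = \sum_(i <- s) cintegral mu (h i) /\ cintegrable mu (S s).
  by [].
elim: s => [|i s [IH1 IH2]].
  have -> : S [::] = (fun x => 0 * (fun=> 0) x).
    by apply/funext => x; rewrite /S big_nil mul0r.
  have st := @step0 p p_pr n C 0.
  rewrite big_nil (step_integralZ _ st) mul0r; split=> //.
  exact: step_cintegrable (stepZ 0 st).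
have -> : S (i :: s) = (fun x => h i x + S s x).
  by apply/funext => x; rewrite /S big_cons.
have [l /step_cintegrable hi] := hs i.
by rewrite big_cons (cintegralD hi IH2) IH1; split=> //; exact: cintegrableD.
Qed.

Lemma step_integral_pind l : cintegral mu (pind C l) = pball_vol R p n l.
Proof.
have -> : pind C l = (fun x : V => 1 * pind C l (x - 0)).
  by apply/funext => x; rewrite mul1r subr0.
by rewrite (cintegral_pind mu_haar l 0 1).2 mul1r.
Qed.

End StepIntegral.

(** * The Fourier transform of step functions: inversion and dilations *)

Section Fourier.
Variables (R : realType) (p : nat) (p_pr : prime p) (n : nat).
Local Notation C := R[i].
Local Notation Qp := (padic p_pr).
Local Notation P := (p%:R : rat).
Local Notation V := 'rV[Qp]_n.
Local Notation chi := (padic_char R).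
Local Notation vol := (pball_vol R p n).
Implicit Types (x y xi a : V) (h : V -> C).

Lemma padic_dotC x y : padic_dot x y = padic_dot y x.
Proof. by apply: eq_bigr => j _; rewrite mulrC. Qed.

Lemma padic_dotDr x y z : padic_dot x (y + z) = padic_dot x y + padic_dot x z.
Proof. by rewrite -big_split; apply: eq_bigr => j _; rewrite mxE mulrDr. Qed.

Lemma padic_dotZr t x y : padic_dot x (t *: y) = t * padic_dot x y.
Proof. by rewrite mulr_sumr; apply: eq_bigr => j _; rewrite mxE mulrCA. Qed.

Lemma padic_dotZl t x y : padic_dot (t *: x) y = t * padic_dot x y.
Proof. by rewrite padic_dotC padic_dotZr padic_dotC. Qed.

Lemma padic_dot_bound l m x y : pball l x -> pball m y ->
  padic_norm (padic_dot x y) <= P ^ (l + m).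
Proof.
move=> /pballP hx /pballP hy.
apply: (big_ind (fun z => padic_norm z <= P ^ (l + m))) => [|u v hu hv|j _].
- by rewrite padic_norm0 exprz_p_ge0.
- by apply: le_trans (padic_normD _ _) _; rewrite ge_max hu.
- by rewrite padic_normM expfzDr ?p_neq0 // ler_pM ?padic_norm_ge0.
Qed.

(** B_(-l) annihilates B_l: the dot products lie in Z_p. *)
Lemma padic_char_dual l xi x : pball (- l) xi -> pball l x ->
  chi (padic_dot xi x) = 1.
Proof.
move=> hxi hx; apply: padic_char_small.
by have := padic_dot_bound hxi hx; rewrite addNr.
Qed.

Lemma step_char l h xi : step l h ->
  exists m, step m (fun x => chi (padic_dot xi x) * h x).
Proof.
move=> hh; have [k hk] := pball_exists xi.
have ml : Num.min (- k) l <= l by rewrite ge_min lexx orbT.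
(* A frequency in B_k gives a character trivial on B_(-k), so the product is invariant under the
   smaller of B_(-k) and B_l. *)
exists (Num.min (- k) l); apply: step_mul; first exact: step_refine hh.
move=> x u hu; rewrite padic_dotDr padic_charD.
rewrite (@padic_char_dual (- k) xi u) ?mulr1 ?opprK //.
by apply: pballW hu; rewrite ge_min lexx.
Qed.

Variable mu : {measure set (padic_borel p_pr n) -> \bar R}.
Hypothesis mu_haar : is_haar mu.

Lemma fourier_pind0 l xi : fourier mu (pind C l) xi = vol l * pind C (- l) xi.
Proof.
pose F x : C := chi (padic_dot xi x) * pind C l x.
rewrite -[LHS]/(cintegral mu F).
have [hxi|hxi] := pselect (pball (- l) xi).
  rewrite (pindE _ hxi) mulr1 -(step_integral_pind mu_haar); congr cintegral.
  apply/funext => x; rewrite /F; have [hx|hx] := pselect (pball l x).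
    by rewrite (padic_char_dual hxi hx) mul1r.
  by rewrite (pindN _ hx) mulr0.
rewrite (pindN _ hxi) mulr0.
have [j hj] : exists j, P ^ (- l) < padic_norm (xi 0 j).
  apply: contra_notP hxi => no; apply/pballP => j.
  by rewrite leNgt; apply/negP => hj; apply: no; exists j.
have xij0 : xi 0 j != 0.
  by rewrite -padic_norm_eq0 gt_eqF // (lt_trans _ hj) // exprz_p_gt0.
(* [x0] is built so that [xi . x0 = 1/p], a point where the character is known to be nontrivial. *)
pose x0 : V := (p%:R^-1 * (xi 0 j)^-1) *: delta_mx 0 j.
have dx0 : padic_dot xi x0 = p%:R^-1.
  rewrite padic_dotZr /padic_dot (bigD1 j) //= big1 => [|i ij].
    by rewrite mxE !eqxx mulr1 addr0 divfK.
  by rewrite mxE (negPf ij) andbF mulr0.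
have hx0 : pball l x0.
  apply/pballP => i; rewrite !mxE eqxx /=; have [_|_] := eqVneq i j; last first.
    by rewrite mulr0 padic_norm0 exprz_p_ge0.
  rewrite mulr1 padic_normM !padic_normV padic_norm_p invrK.
  rewrite ler_pdivrMr ?padic_norm_gt0 //.
  (* Norms being powers of p, exceeding p^(-l) means at least p^(-l+1); this spare factor p pays for
     the division by p in [x0]. *)
  have h1 : P ^ (- l + 1) <= padic_norm (xi 0 j).
    by rewrite leNgt; apply/negP => /padic_norm_discrete; rewrite leNgt hj.
  apply: le_trans (_ : P ^ l * P ^ (- l + 1) <= _); last first.
    by rewrite ler_pM2l ?exprz_p_gt0.
  by rewrite -expfzDr ?p_neq0 // addrA subrr add0r expr1z.
have [m hm] : exists m, step m F by exact/step_char/step_pind.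
have E : (fun x => F (x + x0)) = (fun x : V => chi (p%:R^-1 : Qp) * F x).
  apply/funext => x; rewrite /F padic_dotDr padic_charD dx0.
  have -> : pind C l (x + x0) = pind C l x by exact: (@step_pind p p_pr n C l).1.
  by rewrite -mulrA mulrCA.
(* Translating by [x0] multiplies the integral by [chi(1/p)], which differs from 1, and also
   preserves it; so it is 0. *)
have := step_integral_translate mu_haar x0 hm.
rewrite E (step_integralZ mu_haar _ hm) => /eqP.
rewrite -subr_eq0 -{2}[cintegral mu F]mul1r -mulrBl mulf_eq0 subr_eq0.
by rewrite (negPf (padic_charV_neq1 _ _)) => /eqP.
Qed.

Lemma fourier_pind l a xi : fourier mu (fun x => pind C l (x - a)) xi =
  chi (padic_dot xi a) * (vol l * pind C (- l) xi).
Proof.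
have [m hm] : exists m, step m (fun x => chi (padic_dot xi x) * pind C l (x - a)).
  exact/step_char/step_translate/step_pind.
have [k hk] : exists k, step k (fun x => chi (padic_dot xi x) * pind C l x).
  exact/step_char/step_pind.
rewrite /fourier -(step_integral_translate mu_haar a hm) -fourier_pind0 /fourier.
rewrite -(step_integralZ mu_haar _ hk); congr cintegral; apply/funext => x.
by rewrite addrK padic_dotDr padic_charD -mulrA mulrCA.
Qed.

Lemma fourierZ l h c xi : step l h ->
  fourier mu (fun x => c * h x) xi = c * fourier mu h xi.
Proof.
move=> /(step_char xi)[m hm]; rewrite /fourier -(step_integralZ mu_haar _ hm).
by congr cintegral; apply/funext => x; rewrite mulrCA.
Qed.

Lemma fourier_bigsum (I : Type) (s : seq I) (h : I -> V -> C) xi :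
  (forall i, exists l, step l (h i)) ->
  fourier mu (fun x => \sum_(i <- s) h i x) xi = \sum_(i <- s) fourier mu (h i) xi.
Proof.
move=> hs; rewrite /fourier -(step_integral_sum mu_haar).
  by congr cintegral; apply/funext => x; rewrite mulr_sumr.
by move=> i; have [l /(step_char xi)] := hs i.
Qed.

Lemma fourier_sum l (s : seq (C * V)) xi :
  fourier mu (fun x => \sum_(c <- s) c.1 * pind C l (x - c.2)) xi =
  \sum_(c <- s) c.1 * (chi (padic_dot xi c.2) * (vol l * pind C (- l) xi)).
Proof.
have st (a : V) : step l (fun x => pind C l (x - a)).
  exact/step_translate/step_pind.
rewrite fourier_bigsum => [|c]; last by exists l; exact: stepZ.
by apply: eq_bigr => c _; rewrite (fourierZ _ _ (st _)) fourier_pind.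
Qed.

Lemma fourier_fourier l h x : step l h -> fourier mu (fourier mu h) x = h (- x).
Proof.
move=> /step_sum[s ->]; rewrite (funext (fourier_sum l s)).
have st xi : exists m, step m (fun x => chi (padic_dot xi x) * pind C (- l) x).
  exact/step_char/step_pind.
have E : (fun xi => \sum_(c <- s)
    c.1 * (chi (padic_dot xi c.2) * (vol l * pind C (- l) xi))) =
  (fun xi => \sum_(c <- s)
    (c.1 * vol l) * (chi (padic_dot c.2 xi) * pind C (- l) xi)).
  apply/funext => xi; apply: eq_bigr => c _; rewrite padic_dotC; ring.
rewrite E fourier_bigsum => [|c]; last first.
  by have [m hm] := st c.2; exists m; exact: stepZ.
apply: eq_bigr => c _; have [m hm] := st c.2; rewrite (fourierZ _ _ hm).
(* The phase left by the inner transform is a character of frequency [c.2], which shifts the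
   argument of the outer one. *)
have -> : fourier mu (fun xi => chi (padic_dot c.2 xi) * pind C (- l) xi) x =
    fourier mu (pind C (- l)) (x + c.2).
  congr cintegral; apply/funext => xi.
  have -> : padic_dot (x + c.2) xi = padic_dot x xi + padic_dot c.2 xi.
    by rewrite padic_dotC padic_dotDr !(padic_dotC xi).
  by rewrite padic_charD mulrA.
rewrite fourier_pind0 opprK mulrA -[c.1 * _ * _]mulrA (pball_volN R p_pr) mulr1.
congr (_ * _).
have -> : - x - c.2 = - (x + c.2) by rewrite opprD.
have [hx|hx] := pselect (pball l (x + c.2)).
  by rewrite !pindE //; apply/pballN.
by rewrite !pindN //; apply: contra_not hx => /pballN.
Qed.

(** The quotient of volumes is |t|^n. It arises without a change of variables: dilating the argument
    by t turns indicators of level l into indicators of level l - k. *)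
Lemma fourier_dilate l k t h x : padic_norm t = P ^ k -> step l h ->
  fourier mu h (t^-1 *: x) =
  (vol l / vol (l - k)) * fourier mu (fun y => h (t *: y)) x.
Proof.
move=> tk /step_sum[s ->].
have t0 : t != 0 by rewrite -padic_norm_eq0 tk gt_eqF // exprz_p_gt0.
have pindZ m z : pind C m (t *: z) = pind C (m - k) z.
  have [hz|hz] := pselect (pball (m - k) z).
    by rewrite !pindE // -[m](subrK k); apply: pballZ.
  by rewrite !pindN // -[m](subrK k) pballZE.
have E : (fun y => \sum_(c <- s) c.1 * pind C l (t *: y - c.2)) =
  (fun y => \sum_(c <- [seq (c.1, t^-1 *: c.2) | c <- s])
     c.1 * pind C (l - k) (y - c.2)).
  apply/funext => y; rewrite big_map; apply: eq_bigr => c _ /=.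
  have -> : t *: y - c.2 = t *: (y - t^-1 *: c.2).
    by rewrite scalerBr scalerA mulfV // scale1r.
  by rewrite pindZ.
rewrite E !fourier_sum big_map mulr_sumr; apply: eq_bigr => c _ /=.
rewrite padic_dotZl padic_dotZr.
have -> : pind C (- l) (t^-1 *: x) = pind C (- (l - k)) x.
  by rewrite -[x in RHS](scalerKV t0) pindZ; congr pind; lia.
have v0 := pball_vol_neq0 R p_pr n (l - k).
by field.
Qed.

(** Reflection is the dilation by -1, whose norm is p^0, so the volume factor is 1. *)
Lemma fourierN l h x : step l h ->
  fourier mu h (- x) = fourier mu (fun y => h (- y)) x.
Proof.
have N1 : padic_norm (-1 : Qp) = P ^ 0 by rewrite padic_normN padic_norm1 expr0z.
move=> hh; have := fourier_dilate x N1 hh.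
have -> : (-1)^-1 *: x = - x by rewrite invrN1 scaleN1r.
have -> : l - 0 = l by rewrite subr0.
rewrite (divff (pball_vol_neq0 R p_pr n l)) mul1r => ->.
by congr fourier; apply/funext => y; rewrite scaleN1r.
Qed.

End Fourier.

(** * Lizorkin test functions, the transposed operator and dilations *)

Section TestFunctions.
Variables (R : realType) (p : nat) (p_pr : prime p) (n : nat).
Local Notation C := R[i].
Local Notation Qp := (padic p_pr).
Local Notation V := 'rV[Qp]_n.
Implicit Types (x y xi : V) (psi u : V -> C).

(** Compactness of the support makes the local levels of constancy uniform, because an ultrametric
    ball is stable under translations by smaller balls. *)
Lemma bruhat_schwartz_step psi : bruhat_schwartz psi -> exists l, step l psi.
Proof.
move=> [psi_lc].
have /choice[L hL] : forall x, exists l, forall h, pball l h -> psi (x + h) = psi x.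
  by move=> x; have /nbhs_pball := psi_lc x.
set K := closure _; rewrite compact_cover.
move=> /(_ V K (fun a => [set y | pball (L a) (y - a)])).
case=> [a _|x Kx|D _ hD]; first exact: open_pball.
  by exists x; rewrite //= subrr; exact: pball0.
have cov x : psi x != 0 -> exists2 a, a \in enum_fset D & pball (L a) (x - a).
  by move=> /(@subset_closure _ _ x)/hD[a /= aD xa]; exists a.
(* The finite subcover has a least level [l], and B_l preserves every ball of it. *)
have [l hl] : exists l, forall a, a \in enum_fset D -> l <= L a.
  elim: (enum_fset D) => [|a s [l hl]]; first by exists 0.
  exists (Num.min (L a) l) => b; rewrite inE => /orP[/eqP->|/hl].
    by rewrite ge_min lexx.
  by rewrite ge_min orbC => ->.
have inv a x k : pball (L a) (x - a) -> pball (L a) k -> psi (x + k) = psi x.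
  have psia y : pball (L a) (y - a) -> psi y = psi a.
    by move=> ya; rewrite -(hL a _ ya) subrKC.
  by move=> xa ak; rewrite !psia // addrAC pballDr.
exists l; split=> [x k lk|].
  have [x0|/cov[a aD xa]] := eqVneq (psi x) 0; last first.
    by apply: inv xa _; apply: pballW lk; exact: hl.
  (* If [psi x = 0] but [psi (x + k)] were not, [x + k] would lie in a covering ball, which then
     contains [x] too. *)
  have [xk0|/cov[a aD xka]] := eqVneq (psi (x + k)) 0; first by rewrite xk0.
  have ak : pball (L a) k by apply: pballW lk; exact: hl.
  by apply: (inv a) => //; apply/(pballDr (x - a) ak); rewrite addrAC.
(* Each covering ball is cut into finitely many cosets of B_l, and these are collected over the
   subcover. *)
have : forall r : seq V, {subset r <= enum_fset D} -> exists s : seq V, forall a x,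
    a \in r -> pball (L a) (x - a) -> exists2 b, b \in s & pball l (x - b).
  elim=> [|a r IH] rD; first by exists [::] => a x; rewrite in_nil.
  have [|s hs] := IH; first by move=> b br; apply: rD; rewrite inE br orbT.
  have [|t ht] := @pball_cover p p_pr n C (L a) l.
    by apply: hl; apply: rD; rewrite inE eqxx.
  exists (s ++ [seq a + b | b <- t]) => b x; rewrite inE => /orP[/eqP->|br] hb.
    have [d dt hd] := ht _ hb; exists (a + d); last by rewrite opprD addrA.
    by rewrite mem_cat map_f ?orbT.
  by have [d ds hd] := hs _ _ br hb; exists d; rewrite // mem_cat ds.
move=> /(_ _ (fun=> id))[s hs]; exists s => x /cov[a aD xa]; exact: hs aD xa.
Qed.

Lemma bruhat_schwartz_subset psi u : bruhat_schwartz psi ->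
  (forall x, \forall y \near x, u y = u x) ->
  (forall x, u x != 0 -> psi x != 0) -> bruhat_schwartz u.
Proof.
move=> [_ Kc] ulc us; split=> //; apply: subclosed_compact Kc _.
  exact: closed_closure.
exact: closure_subset.
Qed.

Lemma Psi_mul (A : V -> C) psi : lc_away0 A -> Psi psi -> Psi (fun x => A x * psi x).
Proof.
move=> A_lc [psi_bs psi0]; split; last by rewrite /= psi0 mulr0.
apply: (bruhat_schwartz_subset psi_bs) => [x|x]; last first.
  by apply: contra_neq => ->; rewrite mulr0.
(* At the origin nothing is known about [A], but [psi] vanishes on a neighbourhood of it. *)
have [->|x0] := eqVneq x 0.
  by apply: filterS (psi_bs.1 0) => y ->; rewrite psi0 !mulr0.
by apply: filterS2 (A_lc _ x0) (psi_bs.1 x) => y -> ->.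
Qed.

Lemma PsiZ c psi : Psi psi -> Psi (fun x => c * psi x).
Proof.
move=> psiP; apply: (@Psi_mul (fun=> c)) => // x _.
by apply/nbhs_pball; exists 0.
Qed.

Lemma scale_continuous (t : Qp) : t != 0 -> continuous (fun x => t *: x).
Proof.
move=> t0 x S /= /nbhs_pball[l hl]; apply/nbhs_pball.
have [k tk] := padic_norm_value t0; exists (l - k) => h hh /=.
by rewrite scalerDr; apply: hl; rewrite -[l](subrK k); exact: pballZ.
Qed.

Lemma Psi_dilate t psi : t != 0 -> Psi psi -> Psi (fun x => psi (t *: x)).
Proof.
move=> t0 [[psi_lc Kc] psi0]; split; last by rewrite /= scaler0.
have tc := scale_continuous t0; split; first by move=> x; exact: tc (psi_lc _).
have tV0 : t^-1 != 0 by rewrite invr_eq0.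
(* The support of the dilated function sits in the image of the old support under the inverse
   homothety. *)
have Kc' : compact ((fun x => t^-1 *: x) @` closure [set x | psi x != 0]).
  apply: continuous_compact Kc; apply: continuous_subspaceT.
  exact: scale_continuous.
apply: subclosed_compact Kc' _; first exact: closed_closure.
move=> x xK; exists (t *: x); last by rewrite scalerA mulVf // scale1r.
move=> S /tc/xK[y [/= ypsi yS]]; by exists (t *: y).
Qed.

Variable mu : {measure set (padic_borel p_pr n) -> \bar R}.
Hypothesis mu_haar : is_haar mu.

Lemma Psi_step psi : Psi psi -> exists l, step l psi.
Proof. by move=> [/bruhat_schwartz_step]. Qed.

(** Twice F reflects [psi], which matches the reflected symbol: the integrand contains (A psi)(-xi),
    and the conjugate character of the inverse transform undoes this reflection. *)
Lemma pdo_transpose_fourier (A : V -> C) psi : lc_away0 A -> Psi psi ->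
  pdo_transpose mu A (fourier mu psi) = fourier mu (fun x => A x * psi x).
Proof.
move=> A_lc psiP; apply/funext => x.
have [l hl] := Psi_step psiP; have [m hm] := Psi_step (Psi_mul A_lc psiP).
rewrite -[x in RHS]opprK (fourierN mu_haar _ hm); congr cintegral.
apply/funext => xi; rewrite (fourier_fourier mu_haar _ hl).
have -> : padic_dot (- x) xi = - padic_dot xi x.
  by rewrite -scaleN1r padic_dotZl mulN1r padic_dotC.
by [].
Qed.

Lemma PhiZ c phi : Phi mu phi -> Phi mu (fun x => c * phi x).
Proof.
move=> [psi psiP <-]; exists (fun x => c * psi x); first exact: PsiZ.
have [l hl] := Psi_step psiP.
by apply/funext => x; rewrite (fourierZ mu_haar _ _ hl).
Qed.

Lemma Phi_dilate t phi : t != 0 -> Phi mu phi -> Phi mu (fun x => phi (t^-1 *: x)).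
Proof.
move=> t0 [psi psiP <-]; have [l hl] := Psi_step psiP.
have [k tk] := padic_norm_value t0.
have -> : (fun x => fourier mu psi (t^-1 *: x)) =
    (fun x => pball_vol R p n l / pball_vol R p n (l - k) *
              fourier mu (fun y => psi (t *: y)) x).
  by apply/funext => x; rewrite (fourier_dilate mu_haar x tk hl).
by apply: PhiZ; exists (fun y => psi (t *: y)) => //; exact: Psi_dilate.
Qed.

Section Homogeneous.
Variables (A : V -> C) (chi : Qp -> C).
Hypothesis A_lc : lc_away0 A.
Hypothesis A_hom : homogeneous_symbol A chi.

Lemma Phi_pdo_transpose phi : Phi mu phi -> Phi mu (pdo_transpose mu A phi).
Proof.
move=> [psi psiP <-]; rewrite pdo_transpose_fourier //.
by exists (fun x => A x * psi x) => //; exact: Psi_mul.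
Qed.

(** The preimage is obtained by dividing by the symbol on the Fourier side; [A^-1] is again locally
    constant away from 0. *)
Lemma pdo_transpose_surj phi : (forall xi, xi != 0 -> A xi != 0) -> Phi mu phi ->
  exists2 phi', Phi mu phi' & pdo_transpose mu A phi' = phi.
Proof.
move=> A0 [psi psiP <-].
have AV_lc : lc_away0 (fun x => (A x)^-1).
  by move=> x x0; apply: filterS (A_lc x0) => y ->.
have hP := Psi_mul AV_lc psiP.
exists (fourier mu (fun x => (A x)^-1 * psi x)).
  by exists (fun x => (A x)^-1 * psi x).
rewrite pdo_transpose_fourier //; congr fourier; apply/funext => x.
have [->|x0] := eqVneq x 0; first by rewrite psiP.2 !mulr0.
by rewrite mulVKf // A0.
Qed.

(** Taken at one common level, [psi] and [A psi] have the same dilation factor under F. What remains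
    to compare is [A y] with [(chi t)^-1 * A (t *: y)]. *)
Lemma pdo_transpose_dilate t phi : t != 0 -> chi t != 0 -> Phi mu phi ->
  pdo_transpose mu A (fun x => phi (t^-1 *: x)) =
  (fun x => (chi t)^-1 * pdo_transpose mu A phi (t^-1 *: x)).
Proof.
move=> t0 chit0 [psi psiP <-]; have APsi := Psi_mul A_lc psiP.
have [l1 hl1] := Psi_step psiP; have [l2 hl2] := Psi_step APsi.
pose l := Num.min l1 l2.
have hl : step l psi by apply: step_refine hl1; rewrite ge_min lexx.
have {hl1 hl2} hAl : step l (fun x => A x * psi x).
  by apply: step_refine hl2; rewrite ge_min lexx orbT.
have [k tk] := padic_norm_value t0.
have psitP := Psi_dilate t0 psiP; have ApsitP := Psi_dilate t0 APsi.
have [m hm] := Psi_step psitP; have [m' hm'] := Psi_step ApsitP.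
pose c : C := pball_vol R p n l / pball_vol R p n (l - k).
have -> : (fun x => fourier mu psi (t^-1 *: x)) =
    fourier mu (fun y => c * psi (t *: y)).
  apply/funext => x; rewrite (fourier_dilate mu_haar x tk hl).
  by rewrite (fourierZ mu_haar _ _ hm).
rewrite !pdo_transpose_fourier //; last exact: PsiZ.
apply/funext => x; rewrite (fourier_dilate mu_haar x tk hAl) -/c mulrA.
rewrite -(fourierZ mu_haar _ _ hm'); congr fourier; apply/funext => y.
(* Homogeneity says nothing at the origin, where both sides vanish with [psi]. *)
have [->|y0] := eqVneq y 0; first by rewrite scaler0 psiP.2 !mulr0.
by rewrite A_hom //; field.
Qed.

End Homogeneous.

(** Linearity is given for a phi + psi; here psi = 0, which is in Phi as 0 times [phi]. *)
Lemma lizorkin_distributionZ f c phi : lizorkin_distribution mu f ->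
  Phi mu phi -> f (fun x => c * phi x) = c * f phi.
Proof.
move=> [f_lin _] phiP.
have P0 : Phi mu (fun=> 0).
  have := PhiZ 0 phiP; rewrite (_ : (fun x => 0 * phi x) = (fun=> 0)) //.
  by apply/funext => x; rewrite mul0r.
have f0 : f (fun=> 0) = 0.
  have := f_lin 1 _ _ P0 P0; rewrite !mul1r addr0 => /eqP.
  by rewrite -subr_eq subrr eq_sym => /eqP.
have := f_lin c _ _ phiP P0; rewrite f0 addr0 => <-; congr f.
by apply/funext => x; rewrite addr0.
Qed.

(** The scalar released by commuting with the dilation cancels against the rescaled denominator. The
    equality holds for each t, also at zeros of [rho], where both sides are 0. *)
Lemma dilate_pdo (A : V -> C) (chi rho : Qp -> C) f phi t :
  lc_away0 A -> homogeneous_symbol A chi -> lizorkin_distribution mu f ->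
  Phi mu phi -> t != 0 -> chi t != 0 ->
  dilate (pdo mu A f) t phi / ((chi t)^-1 * rho t) =
  dilate f t (pdo_transpose mu A phi) / rho t.
Proof.
move=> A_lc A_hom f_dist phiP t0 chit0; rewrite /dilate /pdo.
rewrite (pdo_transpose_dilate A_lc A_hom) // lizorkin_distributionZ //; last first.
  exact/Phi_dilate/Phi_pdo_transpose.
by rewrite mulrCA invfM invrK mulrACA mulVf // mul1r.
Qed.

End TestFunctions.

Theorem theorem7p5 (R : realType) (p : nat) (p_pr : prime p)
    (n : nat) (n_ge1 : (1 <= n)%N)
    (mu : {measure set (padic_borel p_pr n) -> \bar R}) (mu_haar : is_haar mu)
    (A : 'rV[padic p_pr]_n -> R[i]) (A_lc : lc_away0 A)
    (A_neq0 : forall xi : 'rV[padic p_pr]_n, xi != 0 -> A xi != 0)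
    (beta : R[i]) (pi1 : padic p_pr -> R[i]) (pi1_char : is_unitary_char pi1)
    (A_hom : homogeneous_symbol A (mult_char beta pi1))
    (f g : ('rV[padic p_pr]_n -> R[i]) -> R[i])
    (f_dist : lizorkin_distribution mu f) (g_dist : lizorkin_distribution mu g)
    (rho : padic p_pr -> R[i]) (rho_automodel : automodel rho) :
  quasi_asymptotic mu f g rho <->
  quasi_asymptotic mu (pdo mu A f) (pdo mu A g)
    (fun t => (mult_char beta pi1 t)^-1 * rho t).
Proof.
(* The character is nonzero because it relates the nonzero values of [A] at (1, ..., 1) and at its
   multiple by t; this vector is nonzero as n >= 1. *)
have chi0 t : t != 0 -> mult_char beta pi1 t != 0.
  move=> t0; pose e : 'rV[padic p_pr]_n := const_mx 1.
  have e0 : e != 0.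
    apply/eqP => /rowP/(_ (Ordinal n_ge1)); rewrite !mxE => /eqP.
    by rewrite oner_eq0.
  have := A_neq0 (t *: e); rewrite scaler_eq0 negb_or t0 e0 => /(_ isT).
  by rewrite A_hom // mulf_eq0 negb_or => /andP[].
have dilateE phi : Phi mu phi -> \forall t \near @padic_infty p p_pr,
    dilate f t (pdo_transpose mu A phi) / rho t =
    dilate (pdo mu A f) t phi / ((mult_char beta pi1 t)^-1 * rho t).
  (* The bound 0 suffices: a positive norm just means t <> 0. *)
  move=> phiP; exists 0 => t; rewrite lt_def padic_norm_eq0 => /andP[t0 _].
  by have := dilate_pdo mu_haar rho A_lc A_hom f_dist phiP t0 (chi0 t t0).
have cvgE phi (l : R[i]) : Phi mu phi ->
    (fun t => dilate f t (pdo_transpose mu A phi) / rho t) @ (@padic_infty p p_pr) --> l <->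
    (fun t => dilate (pdo mu A f) t phi / ((mult_char beta pi1 t)^-1 * rho t))
      @ (@padic_infty p p_pr) --> l.
  move=> phiP; split; apply: cvg_trans; apply: near_eq_cvg.
    exact: dilateE.
  by apply: filterS (dilateE _ phiP) => t /esym.
split=> -[[phi phiP gphi] fg]; split.
(* A test function detecting [g] is the image of one detecting [Ag]. *)
- have [phi' phi'P Aphi'] := pdo_transpose_surj mu_haar A_lc A_neq0 phiP.
  by exists phi'; rewrite // /pdo Aphi'.
- move=> phi' phi'P; apply: (cvgE phi' (g (pdo_transpose mu A phi')) phi'P).1.
  exact: fg (Phi_pdo_transpose mu_haar A_lc phi'P).
- exists (pdo_transpose mu A phi) => //; exact: Phi_pdo_transpose.
- move=> phi' phi'P.
  (* By surjectivity every test function for [f] is reached from one for [Af]. *)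
  have [phi2 phi2P <-] := pdo_transpose_surj mu_haar A_lc A_neq0 phi'P.
  apply: (cvgE phi2 (g (pdo_transpose mu A phi2)) phi2P).2.
  exact: fg phi2P.
Qed.
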